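(* Let $J\subset\mathbb{R}$ be a segment and let $(u,g)$ be a pair of complex-valued real-analytic functions on $J$, with $u$ of level $R$ and $g$ of level $S$. Let $\psi(w)=\sum_{n=0}^{\infty}c_nw^n$ be a power series with complex coefficients and radius of convergence $\rho>0$ (possibly infinite). For $t\in J$, the function $\zeta\mapsto\varphi_t(\zeta)=\psi(\zeta-g(t))$ is defined in the open disc with centre $g(t)$ and radius $\rho$. Put $$S_0=\left(1+\frac{N_S(g)}{\rho}\right)S,\qquad T_0=2\max(R,2S_0).$$ Then for every $t\in J$ and every complex number $z$ with $|z|<\dfrac{1}{4N_R(u)T_0}$, the complex number $\sum_{n=0}^{\infty}\frac{1}{n!}D^{n-1}\left(u^nDg\right)(t)\,z^n$ belongs to the open disc with centre $g(t)$ and radius $\rho$, and $$\varphi_t\left(\sum_{n=0}^{\infty}\frac{1}{n!}D^{n-1}\left(u^{n}Dg\right)(t)\,z^{n}\right)=\sum_{n=0}^{\infty}\frac{1}{n!}D^{n-1}\left(u^{n}D(\varphi_t\circ g)\right)(t)\,z^{n}.$$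
   Context: A segment is a compact real interval with at least two points. $D$ is differentiation on the real interval; $\|\cdot\|$ is the sup norm on $J$. For $R>0$, a complex-valued $\mathcal{C}^\infty$ function $g$ on $J$ is said to be (real-analytic) of level $R$ if $N_R(g):=\sup_{p\in\mathbb{N}}\frac{\|D^pg\|}{p!\,R^p}<+\infty$ (a $\mathcal{C}^\infty$ function on $J$ is real-analytic iff it has some level $R>0$). Convention: for $n=0$ the expression $D^{n-1}(u^nDh)$ means $h$. The function $\varphi_t\circ g$ is defined on a neighbourhood of $t$ in $J$. If $\rho=\infty$, $N_S(g)/\rho=0$; if $N_R(u)=0$, $\frac{1}{4N_R(u)T_0}=+\infty$. *)

(* Defs.v *)
From Stdlib Require Export Factorial Reals.
From Coquelicot Require Export Coquelicot.

Open Scope R_scope.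

(** A function on the segment [a, b] is represented by a total function
    [R -> C]; every notion below only looks at its values on [a, b]. *)

Definition segment (a b : R) (t : R) : Prop := a <= t <= b.

(** Derivative relative to [a, b]; it is one-sided at the endpoints. *)
Definition is_deriv_on (a b : R) (f : R -> C) (t : R) (l : C) : Prop :=
  filterlim (fun x : R => ((f x - f t) / RtoC (x - t))%C)
    (within (fun x => segment a b x /\ x <> t) (locally t)) (locally l).

Definition D (a b : R) (f : R -> C) : R -> C :=
  fun t => @iota C_CompleteNormedModule (is_deriv_on a b f t).

(** Unspecified values outside [a, b], or at points where a derivative does not
    exist, do not affect iterated derivatives at points near which all the
    derivatives within [a, b] exist. *)
Definition Diter (a b : R) (p : nat) (f : R -> C) : R -> C :=
  Nat.iter p (D a b) f.

Definition smooth_on (a b : R) (f : R -> C) : Prop :=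
  forall (p : nat) (t : R), segment a b t ->
    exists l : C, is_deriv_on a b (Diter a b p f) t l.

Definition supnorm (a b : R) (f : R -> C) : Rbar :=
  Lub_Rbar (fun y => exists t, segment a b t /\ y = Cmod (f t)).

Definition levelN (a b r : R) (f : R -> C) : Rbar :=
  Sup_seq (fun p =>
    Rbar_div (supnorm a b (Diter a b p f)) (Finite (INR (fact p) * r ^ p))).

(** Only meaningful for [0 < r]. *)
Definition of_level (a b r : R) (f : R -> C) : Prop :=
  smooth_on a b f /\ Rbar_lt (levelN a b r f) p_infty.

(** Coquelicot's [CV_radius] is restricted to real coefficients; as it is
    defined through absolute convergence, passing to moduli gives the radius
    of a complex power series. *)
Definition C_radius (c : nat -> C) : Rbar := CV_radius (fun n => Cmod (c n)).

Definition C_PSeries (c : nat -> C) (w : C) : C :=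
  @iota C_CompleteNormedModule (fun l => is_pseries c w l).

Definition ex_C_pseries (c : nat -> C) (w : C) : Prop :=
  exists l : C, is_pseries c w l.

(** [D^{n-1} (u^n D h)], read as [h] for [n = 0]. *)
Definition lagrange_term (a b : R) (u h : R -> C) (n : nat) : R -> C :=
  match n with
  | O => h
  | S m => Diter a b m (fun s => (Cpow (u s) n * D a b h s)%C)
  end.

Definition lagrange_coef (a b : R) (u h : R -> C) (t : R) (n : nat) : C :=
  (RtoC (/ INR (fact n)) * lagrange_term a b u h n t)%C.

(** [1 / x] for [x >= 0], with [1 / 0 = +oo] (unlike [Rbar_inv]). *)
Definition inv_pinfty (x : R) : Rbar :=
  if Req_EM_T x 0 then p_infty else Finite (/ x).

(** [Rbar_div _ p_infty] is [0]. *)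
Definition S0 (a b s : R) (g : R -> C) (rho : Rbar) : R :=
  (1 + real (Rbar_div (levelN a b s g) rho)) * s.

Definition T0 (a b r s : R) (g : R -> C) (rho : Rbar) : R :=
  2 * Rmax r (2 * S0 a b s g rho).

Definition phi (c : nat -> C) (g : R -> C) (t : R) (zeta : C) : C :=
  C_PSeries c (zeta - g t)%C.

(* Main.v *)
From Stdlib Require Import FunctionalExtensionality Lra Lia.
Require Import Defs.

(** The coefficients of the two series are those of Lagrange inversion: if [U]
    and [H] are the Taylor series of [u] and [h] at [t], the coefficient of
    [z^n] is [[X^(n-1)] (U^n H') / n], which depends on no other data.  So the
    theorem splits into an algebraic identity between formal power series, a
    computation of Taylor series, and estimates at the single point [t].

    Algebra.  Let [lagrange U H] be the formal series with those coefficients.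
    The heart of the proof is that [H |-> lagrange U H] is multiplicative
    ([lagrange_mul]).  It is obtained without solving [w = t + z U(w)]: besides
    [lagrange], consider the series [diagonal U K] with coefficients
    [[X^n] (U^n K)].  One has [diagonal U (X K) = X diagonal U (U K)] and
    [diagonal U 1 = 1 + X diagonal U U'], and splitting [K] as
    [K_0 + X K_1] turns these into a proof, by induction on the degree, that
    [lagrange U H * diagonal U K = diagonal U (H K)]
    ([lagrange_mul_diagonal]).  Consequently [lagrange U] commutes with
    substitution of a series without constant term into any power series
    ([lagrange_fcomp]).

    Taylor series.  A family of formal series [F x] whose coefficients satisfy
    [d/dx F x = F x '] is the family of Taylor series of its constant
    coefficient ([taylor_Diter]).  Such families are stable under products, and
    under composition with a convergent power series ([taylor_C_PSeries]); at
    [t] this says that the Taylor series of [phi_t o g] is the formal composite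
    of [psi] with that of [g - g t].

    Estimates.  Since [U] and [G] are dominated by geometric series, a Cauchy
    estimate at the radius [1 / (2 M)], [M = max(R, 2 S_0)], bounds the
    coefficients of [lagrange U G] ([lagrange_l1_le]); for the given [z] the sum
    of the moduli of all terms but the constant one is at most
    [2 N_S(g) S / M], which is less than [rho] ([radius_margin]).  The series
    of [g] without its constant term then lies, with its absolute values,
    inside the disc of convergence of [psi], so the formal composite converges
    to the composite of the sums ([tends_csum_fcomp]). *)

(** * Formal power series *)

Definition fps := nat -> C.

Declare Scope fps_scope.
Delimit Scope fps_scope with fps.
Bind Scope fps_scope with fps.

Definition fconst (c : C) : fps := fun n => match n with O => c | S _ => RtoC 0 end.
Definition fX : fps := fun n => match n with 1%nat => RtoC 1 | _ => RtoC 0 end.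
Definition fadd (F G : fps) : fps := fun n => (F n + G n)%C.
Definition fopp (F : fps) : fps := fun n => (- F n)%C.
Definition fsub (F G : fps) : fps := fadd F (fopp G).
Definition ftail (F : fps) : fps := fun n => F (S n).

(** The Cauchy product, by recursion on the degree through
    [F = F 0 + X * ftail F]: the ring laws, and every later statement about
    products, follow by induction on the degree without reindexing sums. *)
Fixpoint fmul_coef (F G : fps) (n : nat) : C :=
  match n with
  | O => (F O * G O)%C
  | S m => (F O * G n + fmul_coef (ftail F) G m)%C
  end.
Definition fmul (F G : fps) : fps := fmul_coef F G.
Fixpoint fpow (F : fps) (n : nat) : fps :=
  match n with O => fconst 1 | S m => fmul F (fpow F m) end.
Definition fder (F : fps) : fps := fun n => (RtoC (INR (S n)) * F (S n))%C.

Infix "+" := fadd : fps_scope.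
Infix "-" := fsub : fps_scope.
Infix "*" := fmul : fps_scope.
Infix "^" := fpow : fps_scope.
Notation "- F" := (fopp F) : fps_scope.

Lemma fadd_coef F G n : (F + G)%fps n = (F n + G n)%C.
Proof. reflexivity. Qed.

Lemma fmul_S F G n : (F * G)%fps (S n) = (F O * G (S n) + (ftail F * G)%fps n)%C.
Proof. reflexivity. Qed.

Lemma fmul_add_coef n : forall F G H : fps,
  ((F + G) * H)%fps n = ((F * H)%fps n + (G * H)%fps n)%C.
Proof.
  induction n as [|n IH]; intros F G H.
  - unfold fmul, fadd; simpl; ring.
  - rewrite !fmul_S. change (ftail (F + G)) with (ftail F + ftail G)%fps.
    rewrite IH. unfold fadd; ring.
Qed.

Lemma fmul_const_coef n : forall (c : C) (F G : fps),
  ((fun i => c * F i)%C * G)%fps n = (c * (F * G)%fps n)%C.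
Proof.
  induction n as [|n IH]; intros c F G.
  - unfold fmul; simpl; ring.
  - rewrite !fmul_S. change (ftail (fun i => c * F i)%C) with (fun i => c * ftail F i)%C.
    rewrite IH; ring.
Qed.

Lemma fmul_S_r n : forall F G : fps,
  (F * G)%fps (S n) = (F (S n) * G O + (F * ftail G)%fps n)%C.
Proof.
  induction n as [|n IH]; intros F G.
  - unfold fmul; simpl; unfold ftail; ring.
  - rewrite fmul_S, IH, fmul_S. unfold ftail; ring.
Qed.

Lemma fmul_comm F G : (F * G = G * F)%fps.
Proof.
  apply functional_extensionality; intro n; revert F G.
  induction n as [|n IH]; intros F G.
  - unfold fmul; simpl; ring.
  - rewrite fmul_S, fmul_S_r, IH; ring.
Qed.

Lemma fmul_add_l F G H : ((F + G) * H = F * H + G * H)%fps.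
Proof. apply functional_extensionality; intro n; apply fmul_add_coef. Qed.

Lemma ftail_mul F G : ftail (F * G)%fps = ((fun i => F O * ftail G i)%C + ftail F * G)%fps.
Proof. reflexivity. Qed.

Lemma fmul_assoc F G H : (F * (G * H) = F * G * H)%fps.
Proof.
  apply functional_extensionality; intro n; revert F G H.
  induction n as [|n IH]; intros F G H.
  - unfold fmul; simpl; ring.
  - rewrite (fmul_S F), (fmul_S (F * G)%fps), ftail_mul, fmul_add_coef, fmul_const_coef,
      <- IH, (fmul_S G).
    change ((F * G)%fps O) with (F O * G O)%C. ring.
Qed.

Lemma fmul_const c F n : (fconst c * F)%fps n = (c * F n)%C.
Proof.
  destruct n as [|n]; [reflexivity|].
  rewrite fmul_S. change (ftail (fconst c)) with (fun _ : nat => RtoC 0).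
  replace (fun _ : nat => RtoC 0) with (fun i : nat => RtoC 0 * RtoC 0)%C
    by (apply functional_extensionality; intro; ring).
  rewrite fmul_const_coef; simpl; ring.
Qed.

Lemma fps_ring_theory :
  ring_theory (fconst 0) (fconst 1) fadd fmul fsub fopp (@eq fps).
Proof.
  split; try reflexivity.
  - intro F; apply functional_extensionality; intros [|n]; unfold fadd; simpl; ring.
  - intros F G; apply functional_extensionality; intro n; unfold fadd; ring.
  - intros F G H; apply functional_extensionality; intro n; unfold fadd; ring.
  - intro F; apply functional_extensionality; intro n; rewrite fmul_const; ring.
  - exact fmul_comm.
  - exact fmul_assoc.
  - exact fmul_add_l.
  - intro F; apply functional_extensionality; intros [|n]; unfold fadd, fopp; simpl; ring.
Qed.

Lemma fps_power_theory :
  power_theory (fconst 1) fmul (@eq fps) BinNat.N.to_nat fpow.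
Proof.
  constructor. intros F n; destruct n as [|p]; [reflexivity|]. simpl.
  induction p as [|p IH] using Pos.peano_ind.
  - simpl. rewrite fmul_comm. apply functional_extensionality; intro n.
    rewrite fmul_const; ring.
  - rewrite Pos2Nat.inj_succ; simpl. rewrite IH.
    symmetry. apply (pow_pos_succ (@Eqsth fps)); [|exact fmul_assoc].
    repeat intro; subst; reflexivity.
Qed.

Ltac fps_pow_cst t :=
  match isnatcst t with
  | false => constr:(InitialRing.NotConstant)
  | _ => constr:(BinNat.N.of_nat t)
  end.

Add Ring fps_ring : fps_ring_theory (power_tac fps_power_theory [fps_pow_cst]).

Lemma fmul_X_S F n : (fX * F)%fps (S n) = F n.
Proof.
  rewrite fmul_S. change (ftail fX) with (fconst 1).
  rewrite fmul_const; simpl; ring.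
Qed.

Lemma fmul_X_0 F : (fX * F)%fps O = 0.
Proof. unfold fmul; simpl; ring. Qed.

Lemma fps_split F : F = (fconst (F O) + fX * ftail F)%fps.
Proof.
  apply functional_extensionality; intros [|n]; unfold fadd.
  - rewrite fmul_X_0; simpl; ring.
  - rewrite fmul_X_S; unfold ftail; simpl; ring.
Qed.

Lemma fmul_ext_l n : forall F F' G : fps,
  (forall i, (i <= n)%nat -> F i = F' i) -> (F * G)%fps n = (F' * G)%fps n.
Proof.
  induction n as [|n IH]; intros F F' G E.
  - unfold fmul; simpl; rewrite E; [reflexivity|lia].
  - rewrite !fmul_S, (E O) by lia. f_equal. apply IH.
    intros i Hi; apply E; lia.
Qed.

Lemma fpow_0_coef F n : (F ^ n)%fps O = Cpow (F O) n.
Proof. induction n as [|n IH]; [reflexivity|]. simpl. rewrite <- IH. reflexivity. Qed.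

Lemma fder_add F G : fder (F + G)%fps = (fder F + fder G)%fps.
Proof. apply functional_extensionality; intro n; unfold fder, fadd; ring. Qed.

Lemma fder_const c : fder (fconst c) = fconst 0.
Proof. apply functional_extensionality; intros [|n]; unfold fder; simpl; ring. Qed.

Lemma fder_const_mul c F : fder (fconst c * F)%fps = (fconst c * fder F)%fps.
Proof.
  apply functional_extensionality; intro n; unfold fder.
  rewrite !fmul_const; ring.
Qed.

Lemma fder_X_mul F : fder (fX * F)%fps = (F + fX * fder F)%fps.
Proof.
  apply functional_extensionality; intros [|n]; unfold fder, fadd.
  - rewrite fmul_X_S, fmul_X_0; simpl; ring.
  - rewrite !fmul_X_S, (S_INR (S n)), RtoC_plus. ring.
Qed.

Lemma fder_mul F G : fder (F * G)%fps = (fder F * G + F * fder G)%fps.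
Proof.
  apply functional_extensionality; intro n; revert F G.
  induction n as [|n IH]; intros F G.
  - unfold fder, fadd. rewrite fmul_S. unfold fmul, ftail; simpl. ring.
  - pattern F at 1 2 3; rewrite (fps_split F).
    rewrite fder_add, fder_const, fder_X_mul.
    replace ((fconst (F O) + fX * ftail F) * G)%fps
      with (fconst (F O) * G + fX * (ftail F * G))%fps by ring.
    replace ((fconst 0 + (ftail F + fX * fder (ftail F))) * G
             + (fconst (F O) + fX * ftail F) * fder G)%fps
      with (fconst (F O) * fder G + (ftail F * G
             + fX * (fder (ftail F) * G + ftail F * fder G)))%fps by ring.
    rewrite fder_add, fder_const_mul, fder_X_mul.
    rewrite !fadd_coef, !fmul_X_S, IH, !fadd_coef. reflexivity.
Qed.

Lemma fconst_INR_S n :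
  fconst (RtoC (INR (S n))) = (fconst 1 + fconst (RtoC (INR n)))%fps.
Proof.
  apply functional_extensionality; intros [|k]; unfold fadd; cbn [fconst].
  - rewrite S_INR, RtoC_plus; ring.
  - ring.
Qed.

Lemma fder_pow F n :
  fder (F ^ S n)%fps = (fconst (RtoC (INR (S n))) * (F ^ n * fder F))%fps.
Proof.
  induction n as [|n IH].
  - simpl. rewrite fder_mul, fder_const.
    change (RtoC 1) with (RtoC (INR 1)); change (fconst (RtoC (INR 1))) with (fconst 1). ring.
  - change (F ^ S (S n))%fps with (F * F ^ S n)%fps.
    rewrite fder_mul, IH, (fconst_INR_S (S n)). cbn [fpow]. ring.
Qed.

Lemma INR_S_neq0 n : RtoC (INR (S n)) <> 0.
Proof. intro H; apply RtoC_inj in H; exact (not_0_INR (S n) ltac:(lia) H). Qed.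

(** * Lagrange series *)

(** The expansion of [K(w) / (1 - X U'(w))] in powers of [X], where
    [w = X U(w)]. *)
Definition diagonal (U K : fps) : fps := fun n => (U ^ n * K)%fps n.
(** The expansion of [H(w)].  Lagrange's formula for its coefficients is
    [lagrange_coef_S]; the present expression is the one from which
    multiplicativity follows. *)
Definition lagrange (U H : fps) : fps := (diagonal U H - fX * diagonal U (fder U * H))%fps.

Lemma diagonal_add U K K' : diagonal U (K + K')%fps = (diagonal U K + diagonal U K')%fps.
Proof.
  apply functional_extensionality; intro n; unfold diagonal.
  replace (U ^ n * (K + K'))%fps with (U ^ n * K + U ^ n * K')%fps by ring. reflexivity.
Qed.

Lemma diagonal_const_mul U c K :
  diagonal U (fconst c * K)%fps = (fconst c * diagonal U K)%fps.
Proof.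
  apply functional_extensionality; intro n; rewrite fmul_const; unfold diagonal.
  replace (U ^ n * (fconst c * K))%fps with (fconst c * (U ^ n * K))%fps by ring.
  apply fmul_const.
Qed.

Lemma diagonal_X_mul U K : diagonal U (fX * K)%fps = (fX * diagonal U (U * K))%fps.
Proof.
  apply functional_extensionality; intros [|n].
  - rewrite fmul_X_0. unfold diagonal. simpl fpow.
    replace (fconst 1 * (fX * K))%fps with (fX * K)%fps by ring. apply fmul_X_0.
  - rewrite fmul_X_S. unfold diagonal.
    replace (U ^ S n * (fX * K))%fps with (fX * (U ^ n * (U * K)))%fps by (simpl; ring).
    apply fmul_X_S.
Qed.

(** The coefficients agree since [(U^(n+1))' = (n+1) U^n U']. *)
Lemma diagonal_one U : diagonal U (fconst 1) = (fconst 1 + fX * diagonal U (fder U))%fps.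
Proof.
  apply functional_extensionality; intros [|n]; unfold fadd.
  - rewrite fmul_X_0. unfold diagonal. simpl. unfold fmul; simpl; ring.
  - rewrite fmul_X_S. unfold diagonal.
    replace (U ^ S n * fconst 1)%fps with (U ^ S n)%fps by ring.
    assert (E : fder (U ^ S n)%fps n = (RtoC (INR (S n)) * (U ^ n * fder U)%fps n)%C)
      by (rewrite fder_pow, fmul_const; reflexivity).
    unfold fder at 1 in E.
    assert (E' : ((U ^ S n)%fps (S n) = (U ^ n * fder U)%fps n)%C).
    { rewrite <- (Cmult_1_l ((U ^ S n)%fps (S n))), <- (Cinv_l _ (INR_S_neq0 n)),
        <- Cmult_assoc, E, Cmult_assoc, Cinv_l by apply INR_S_neq0. ring. }
    rewrite E'. cbn [fconst]. ring.
Qed.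

(** This is [H(w) * (K(w) / (1 - X U'(w))) = (H K)(w) / (1 - X U'(w))] for the
    solution [w] of [w = X U(w)].  Induction on the degree, for all [K] at once:
    [K] divisible by [X] and [K] constant are reduced to the previous degree by
    [diagonal_X_mul] and [diagonal_one]. *)
Lemma lagrange_mul_diagonal U H K : (lagrange U H * diagonal U K = diagonal U (H * K))%fps.
Proof.
  apply functional_extensionality; intro n; revert K.
  (* Both sides, once [K] is split, are a multiple of [lagrange U H] plus [X]
     times the two sides of the identity for one and the same other series. *)
  assert (L : forall K, (lagrange U H * diagonal U K)%fps
    = (fconst (K O) * lagrange U H + fX * (lagrange U H *
        diagonal U (fconst (K O) * fder U + U * ftail K)))%fps).
  { intro K. pattern K at 1; rewrite (fps_split K).
    replace (fconst (K O) + fX * ftail K)%fps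
      with (fconst (K O) * fconst 1 + fX * ftail K)%fps by ring.
    rewrite !diagonal_add, !diagonal_const_mul, diagonal_X_mul, diagonal_one. ring. }
  assert (R : forall K, diagonal U (H * K)%fps
    = (fconst (K O) * lagrange U H + fX *
        diagonal U (H * (fconst (K O) * fder U + U * ftail K)))%fps).
  { intro K. pattern K at 1; rewrite (fps_split K). unfold lagrange.
    replace (H * (fconst (K O) + fX * ftail K))%fps
      with (fconst (K O) * H + fX * (H * ftail K))%fps by ring.
    replace (H * (fconst (K O) * fder U + U * ftail K))%fps
      with (fconst (K O) * (fder U * H) + U * (H * ftail K))%fps by ring.
    rewrite !diagonal_add, !diagonal_const_mul, diagonal_X_mul. ring. }
  induction n as [|n IH]; intro K; rewrite L, R, !fadd_coef.
  - rewrite !fmul_X_0; reflexivity.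
  - rewrite !fmul_X_S, IH; reflexivity.
Qed.

(** [lagrange U K] is a combination of two diagonal series, and multiplying
    them by [lagrange U H] multiplies their arguments by [H]. *)
Lemma lagrange_mul U H K : lagrange U (H * K)%fps = (lagrange U H * lagrange U K)%fps.
Proof.
  unfold lagrange at 1.
  replace (fder U * (H * K))%fps with (H * (fder U * K))%fps by ring.
  rewrite <- (lagrange_mul_diagonal U H K), <- (lagrange_mul_diagonal U H (fder U * K)).
  unfold lagrange. ring.
Qed.

Lemma lagrange_add U H K : lagrange U (H + K)%fps = (lagrange U H + lagrange U K)%fps.
Proof.
  unfold lagrange.
  replace (fder U * (H + K))%fps with (fder U * H + fder U * K)%fps by ring.
  rewrite !diagonal_add; ring.
Qed.

Lemma lagrange_const U c : lagrange U (fconst c) = fconst c.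
Proof.
  unfold lagrange.
  replace (diagonal U (fconst c)) with (diagonal U (fconst c * fconst 1)%fps) by (f_equal; ring).
  replace (fder U * fconst c)%fps with (fconst c * fder U)%fps by ring.
  rewrite !diagonal_const_mul, diagonal_one. ring.
Qed.

Lemma lagrange_pow U H k : lagrange U (H ^ k)%fps = (lagrange U H ^ k)%fps.
Proof.
  induction k as [|k IH]; [apply lagrange_const|].
  simpl; rewrite lagrange_mul, IH; reflexivity.
Qed.

Lemma lagrange_coef_0 U H : lagrange U H O = H O.
Proof.
  unfold lagrange, fsub, fadd, fopp. rewrite fmul_X_0.
  unfold diagonal. cbn [fpow]. rewrite fmul_const; ring.
Qed.

(** Lagrange's formula for the coefficients, from the Leibniz rule for
    [U^(n+1) H]. *)
Lemma lagrange_coef_S U H n :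
  (RtoC (INR (S n)) * lagrange U H (S n))%C = (U ^ S n * fder H)%fps n.
Proof.
  unfold lagrange, fsub, fadd, fopp. rewrite fmul_X_S. unfold diagonal.
  replace (U ^ n * (fder U * H))%fps with ((U ^ n * fder U) * H)%fps by ring.
  assert (E : fder (U ^ S n * H)%fps n
    = (RtoC (INR (S n)) * (U ^ n * fder U * H)%fps n + (U ^ S n * fder H)%fps n)%C).
  { rewrite fder_mul, fder_pow. rewrite fadd_coef. f_equal.
    rewrite <- fmul_assoc. apply fmul_const. }
  unfold fder at 1 in E.
  rewrite Cmult_plus_distr_l, E. ring.
Qed.

Lemma lagrange_ext U H K n :
  (forall i, (i <= n)%nat -> H i = K i) -> lagrange U H n = lagrange U K n.
Proof.
  intro E. unfold lagrange, fsub, fadd, fopp. f_equal.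
  - unfold diagonal. rewrite !(fmul_comm (U ^ n)%fps). apply fmul_ext_l, E.
  - destruct n as [|n]; [rewrite !fmul_X_0; reflexivity|].
    rewrite !fmul_X_S. unfold diagonal. f_equal.
    rewrite !fmul_assoc, !(fmul_comm (U ^ n * fder U)%fps).
    apply fmul_ext_l; intros i Hi; apply E; lia.
Qed.

(** * Finite sums *)

(** [sum_n] typed in the carriers themselves, so that ring identities apply. *)
Definition csum (a : nat -> C) (n : nat) : C := sum_n a n.
Definition rsum (a : nat -> R) (n : nat) : R := sum_n a n.

Lemma csum_0 a : csum a O = a O.
Proof. exact (sum_O a). Qed.

Lemma rsum_0 a : rsum a O = a O.
Proof. exact (sum_O a). Qed.

Lemma csum_S a n : csum a (S n) = (csum a n + a (S n))%C.
Proof. exact (sum_Sn a n). Qed.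

Lemma rsum_S a n : rsum a (S n) = rsum a n + a (S n).
Proof. exact (sum_Sn a n). Qed.

Lemma csum_shift a n : csum a (S n) = (a O + csum (fun k => a (S k)) n)%C.
Proof.
  induction n as [|n IH].
  - rewrite csum_S, !csum_0; reflexivity.
  - rewrite csum_S, IH, (csum_S (fun k => a (S k))); ring.
Qed.

Lemma rsum_shift a n : rsum a (S n) = a O + rsum (fun k => a (S k)) n.
Proof.
  induction n as [|n IH].
  - rewrite rsum_S, !rsum_0; reflexivity.
  - rewrite rsum_S, IH, (rsum_S (fun k => a (S k))); ring.
Qed.

Lemma csum_ext a b n : (forall k, (k <= n)%nat -> a k = b k) -> csum a n = csum b n.
Proof. exact (sum_n_ext_loc a b n). Qed.

Lemma csum_plus a b n : csum (fun k => a k + b k)%C n = (csum a n + csum b n)%C.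
Proof. exact (sum_n_plus a b n). Qed.

Lemma csum_mul c a n : csum (fun k => c * a k)%C n = (c * csum a n)%C.
Proof. exact (sum_n_mult_l (K := C_Ring) c a n). Qed.

Lemma csum_switch (u : nat -> nat -> C) m n :
  csum (fun i => csum (u i) n) m = csum (fun j => csum (fun i => u i j) m) n.
Proof. exact (sum_n_switch u m n). Qed.

Lemma Cmod_sum (a : nat -> C) n : Cmod (csum a n) <= rsum (fun k => Cmod (a k)) n.
Proof.
  induction n as [|n IH]; [rewrite !csum_0, ?rsum_0; lra|].
  rewrite csum_S, rsum_S. eapply Rle_trans; [apply Cmod_triangle|lra].
Qed.

(** * Formal composition *)

(** The formal composite when [F] has no constant term: the powers [F^k] with
    [k > n] then do not contribute in degree [n]. *)
Definition fcomp (c : nat -> C) (F : fps) : fps :=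
  fun n => csum (fun k => c k * (F ^ k)%fps n)%C n.

Lemma fpow_low (F : fps) k : F O = RtoC 0 -> forall n, (n < k)%nat -> (F ^ k)%fps n = 0.
Proof.
  intro F0; induction k as [|k IH]; intros n Hn; [lia|].
  cbn [fpow]. rewrite (fps_split F) at 1. rewrite F0.
  replace ((fconst 0 + fX * ftail F) * F ^ k)%fps with (fX * (F ^ k * ftail F))%fps by ring.
  destruct n as [|n]; [apply fmul_X_0|]. rewrite fmul_X_S.
  rewrite (fmul_ext_l n _ (fconst 0)).
  - rewrite fmul_const; ring.
  - intros i Hi. rewrite IH by lia. destruct i; reflexivity.
Qed.

Lemma fcomp_trunc c (F : fps) n N : F O = RtoC 0 -> (n <= N)%nat ->
  fcomp c F n = csum (fun k => c k * (F ^ k)%fps n)%C N.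
Proof.
  intros F0 H; induction H as [|N H IH]; [reflexivity|].
  rewrite csum_S, <- IH, (fpow_low F) by (assumption || lia). ring.
Qed.

(** Truncation of the composite in the exponent of [F] rather than by degree:
    being a polynomial in [F], it is mapped to such a polynomial by
    [lagrange U]. *)
Fixpoint fpoly (c : nat -> C) (F : fps) (N : nat) : fps :=
  match N with
  | O => fconst (c O)
  | S M => (fpoly c F M + fconst (c N) * F ^ N)%fps
  end.

Lemma fpoly_coef c F N n : fpoly c F N n = csum (fun k => c k * (F ^ k)%fps n)%C N.
Proof.
  induction N as [|N IH].
  - rewrite csum_0. cbn [fpoly fpow]. destruct n; cbn [fconst]; ring.
  - rewrite csum_S, <- IH. cbn [fpoly]. rewrite fadd_coef, fmul_const. reflexivity.
Qed.

Lemma lagrange_fpoly U c F N : lagrange U (fpoly c F N) = fpoly c (lagrange U F) N.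
Proof.
  induction N as [|N IH]; cbn [fpoly]; [apply lagrange_const|].
  rewrite lagrange_add, lagrange_mul, lagrange_const, lagrange_pow, IH. reflexivity.
Qed.

Lemma lagrange_fcomp U c (F : fps) :
  F O = RtoC 0 -> lagrange U (fcomp c F) = fcomp c (lagrange U F).
Proof.
  intro F0; apply functional_extensionality; intro n.
  rewrite (lagrange_ext U _ (fpoly c F n)).
  - unfold fcomp; rewrite <- fpoly_coef, lagrange_fpoly. reflexivity.
  - intros i Hi. rewrite fpoly_coef. apply fcomp_trunc; assumption.
Qed.

(** * Limits and dominated convergence *)

Definition tends (u : nat -> C) (l : C) : Prop :=
  forall eps, 0 < eps -> exists N, forall n, (N <= n)%nat -> Cmod (u n - l)%C < eps.

Lemma is_series_tends (a : nat -> C) (l : C) :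
  @is_series C_AbsRing C_NormedModule a l <-> tends (csum a) l.
Proof.
  unfold is_series; split.
  - intros H eps Heps.
    assert (Hs : 0 < sqrt 2) by (apply sqrt_lt_R0; lra).
    assert (He : 0 < eps / sqrt 2) by (apply Rdiv_lt_0_compat; lra).
    destruct (proj1 (filterlim_locally _ _) H (mkposreal _ He)) as [N HN].
    exists N; intros n Hn; specialize (HN n Hn).
    apply C_NormedModule_mixin_compat2 in HN. cbn [pos] in HN.
    replace (sqrt 2 * (eps / sqrt 2)) with eps in HN by (field; lra).
    exact HN.
  - intros H. apply filterlim_locally; intro eps.
    destruct (H eps (cond_pos eps)) as [N HN]. exists N; intros n Hn.
    apply C_NormedModule_mixin_compat1. exact (HN n Hn).
Qed.

Lemma tends_unique u l l' : tends u l -> tends u l' -> l = l'.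
Proof.
  intros H H'.
  destruct (Req_dec (Cmod (l - l')%C) 0) as [E|E].
  - apply Cmod_eq_0 in E. replace l with ((l - l') + l')%C by ring. rewrite E; ring.
  - exfalso. pose proof (Cmod_ge_0 (l - l')%C) as P.
    destruct (H (Cmod (l - l')%C / 2)) as [N HN]; [lra|].
    destruct (H' (Cmod (l - l')%C / 2)) as [N' HN']; [lra|].
    specialize (HN (Nat.max N N') ltac:(lia)). specialize (HN' (Nat.max N N') ltac:(lia)).
    set (x := u (Nat.max N N')) in *.
    replace (l - l')%C with (- (x - l) + (x - l'))%C in P, E, HN, HN' at 1 by ring.
    pose proof (Cmod_triangle (- (x - l))%C (x - l')%C) as T. rewrite Cmod_opp in T.
    replace (- (x - l) + (x - l'))%C with (l - l')%C in * by ring. lra.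
Qed.

Lemma tends_const l : tends (fun _ => l) l.
Proof.
  intros eps He; exists O; intros n _.
  replace (l - l)%C with (RtoC 0) by ring. rewrite Cmod_0; exact He.
Qed.

Lemma tends_plus u v l m : tends u l -> tends v m -> tends (fun n => u n + v n)%C (l + m)%C.
Proof.
  intros Hu Hv eps He.
  destruct (Hu (eps / 2)) as [N HN]; [lra|]. destruct (Hv (eps / 2)) as [N' HN']; [lra|].
  exists (Nat.max N N'); intros n Hn.
  specialize (HN n ltac:(lia)). specialize (HN' n ltac:(lia)).
  replace (u n + v n - (l + m))%C with ((u n - l) + (v n - m))%C by ring.
  eapply Rle_lt_trans; [apply Cmod_triangle|lra].
Qed.

Lemma tends_scal c u l : tends u l -> tends (fun n => c * u n)%C (c * l)%C.
Proof.
  intros Hu eps He. pose proof (Cmod_ge_0 c) as Hc.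
  destruct (Hu (eps / (Cmod c + 1))) as [N HN]; [apply Rdiv_lt_0_compat; lra|].
  exists N; intros n Hn; specialize (HN n Hn).
  replace (c * u n - c * l)%C with (c * (u n - l))%C by ring. rewrite Cmod_mult.
  apply Rle_lt_trans with (Cmod c * (eps / (Cmod c + 1))).
  - apply Rmult_le_compat_l; lra.
  - apply Rmult_lt_reg_r with (Cmod c + 1); [lra|]. field_simplify; nra.
Qed.

Lemma tends_shift u l k : tends u l -> tends (fun n => u (n - k)%nat) l.
Proof.
  intros Hu eps He. destruct (Hu eps He) as [N HN].
  exists (N + k)%nat; intros n Hn; apply HN; lia.
Qed.

Lemma tends_ext u v l : (forall n, u n = v n) -> tends u l -> tends v l.
Proof.
  intros E H eps He; destruct (H eps He) as [N HN].
  exists N; intros n Hn; rewrite <- E; exact (HN n Hn).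
Qed.

Lemma tends_Cmod_le u l c (M : R) :
  tends u l -> (forall n, Cmod (u n - c)%C <= M) -> Cmod (l - c)%C <= M.
Proof.
  intros H B. apply Rnot_lt_le; intro L.
  destruct (H (Cmod (l - c)%C - M)) as [N HN]; [lra|].
  specialize (HN N (le_n N)). specialize (B N).
  pose proof (Cmod_triangle (- (u N - l))%C (u N - c)%C) as T. rewrite Cmod_opp in T.
  replace (- (u N - l) + (u N - c))%C with (l - c)%C in T by ring. lra.
Qed.

Lemma ex_series_tends (a : nat -> C) (B : nat -> R) :
  (forall n, Cmod (a n) <= B n) -> ex_series B -> exists l, tends (csum a) l.
Proof.
  intros H S.
  destruct (@ex_series_le C_AbsRing C_CompleteNormedModule a B H S) as [l Hl].
  exists l. apply is_series_tends, Hl.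
Qed.

Lemma ex_series_bounded (a : nat -> R) (M : R) :
  (forall n, 0 <= a n) -> (forall N, rsum a N <= M) -> ex_series a.
Proof.
  intros P B.
  destruct (ex_finite_lim_seq_incr (rsum a) M) as [l Hl].
  - intro n; rewrite rsum_S; specialize (P (S n)); lra.
  - exact B.
  - exists l; exact Hl.
Qed.

(** Split the sum at a fixed [K]: the head tends to zero termwise and the
    rest is at most a tail of the series [B]. *)
Lemma tannery_vanishing (d : nat -> nat -> C) (B : nat -> R) :
  (forall k N, Cmod (d k N) <= B k) -> ex_series B -> (forall k, tends (d k) 0) ->
  tends (fun N => csum (fun k => d k N) N) 0.
Proof.
  intros HB [s Hs] Hd.
  assert (Head : forall K, tends (fun N => csum (fun k => RtoC (Cmod (d k N))) K) 0).
  { assert (H1 : forall k, tends (fun N => RtoC (Cmod (d k N))) 0).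
    { intros k eps He; destruct (Hd k eps He) as [N HN]; exists N; intros n Hn.
      specialize (HN n Hn).
      replace (d k n - 0)%C with (d k n) in HN by ring.
      replace (RtoC (Cmod (d k n)) - 0)%C with (RtoC (Cmod (d k n))) by ring.
      rewrite Cmod_R, Rabs_pos_eq by apply Cmod_ge_0. exact HN. }
    induction K as [|K IH].
    - apply (tends_ext (fun N => RtoC (Cmod (d O N)))); [|apply H1].
      intro N; rewrite csum_0; reflexivity.
    - apply (tends_ext (fun N => csum (fun k => RtoC (Cmod (d k N))) K
                                + RtoC (Cmod (d (S K) N)))%C).
      + intro N; rewrite csum_S; reflexivity.
      + replace (RtoC 0) with (0 + 0)%C by ring. apply tends_plus; [exact IH|apply H1]. }
  assert (Split : forall K N, (K <= N)%nat ->
    Cmod (csum (fun k => d k N) N)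
      <= Cmod (csum (fun k => RtoC (Cmod (d k N))) K) + (rsum B N - rsum B K)).
  { intros K N HKN.
    assert (E : forall M, (K <= M)%nat -> rsum (fun k => Cmod (d k N)) M
      <= rsum (fun k => Cmod (d k N)) K + (rsum B M - rsum B K)).
    { intros M HM; induction HM as [|M HM IH]; [lra|].
      rewrite !rsum_S. specialize (HB (S M) N). lra. }
    assert (F : forall M, csum (fun k => RtoC (Cmod (d k N))) M
      = RtoC (rsum (fun k => Cmod (d k N)) M)).
    { induction M as [|M IH]; [rewrite !csum_0, ?rsum_0; reflexivity|].
      rewrite csum_S, rsum_S, IH, RtoC_plus; reflexivity. }
    rewrite F, Cmod_R. eapply Rle_trans; [apply Cmod_sum|].
    pose proof (Rle_abs (rsum (fun k => Cmod (d k N)) K)). specialize (E N HKN). lra. }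
  intros eps He.
  assert (Heps : 0 < eps / 4) by lra.
  destruct (proj1 (filterlim_locally _ _) Hs (mkposreal _ Heps)) as [K HK].
  destruct (Head K (eps / 2)) as [N0 HN0]; [lra|].
  exists (Nat.max K N0); intros n Hn.
  specialize (HN0 n ltac:(lia)). specialize (Split K n ltac:(lia)).
  pose proof (HK n ltac:(lia)) as H1. pose proof (HK K (le_n K)) as H2.
  change (Rabs (rsum B n - s) < eps / 4) in H1.
  change (Rabs (rsum B K - s) < eps / 4) in H2.
  apply Rabs_def2 in H1. apply Rabs_def2 in H2.
  replace (csum (fun k => RtoC (Cmod (d k n))) K - 0)%C
    with (csum (fun k => RtoC (Cmod (d k n))) K : C) in HN0
    by (unfold Cminus; rewrite Copp_0, Cplus_0_r; reflexivity).
  unfold Cminus; rewrite Copp_0, Cplus_0_r. lra.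
Qed.

(** Discrete dominated convergence, for sums whose length grows with the
    parameter.  Both the product of two series and the substitution of one
    series into another are instances. *)
Lemma tannery (b : nat -> nat -> C) (beta : nat -> C) (B : nat -> R) :
  (forall k N, Cmod (b k N) <= B k) -> ex_series B -> (forall k, tends (b k) (beta k)) ->
  exists l, tends (csum beta) l /\ tends (fun N => csum (fun k => b k N) N) l.
Proof.
  intros HB SB Hb.
  assert (Hbeta : forall k, Cmod (beta k) <= B k).
  { intro k. replace (beta k) with (beta k - 0)%C by ring.
    apply (tends_Cmod_le (b k)); [apply Hb|]. intro N.
    replace (b k N - 0)%C with (b k N) by ring. apply HB. }
  destruct (ex_series_tends beta B Hbeta SB) as [l Hl].
  exists l; split; [exact Hl|].
  assert (V : tends (fun N => csum (fun k => (b k N + (-1) * beta k)%C) N) 0).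
  { apply (tannery_vanishing (fun k N => b k N + (-1) * beta k)%C (fun k => 2 * B k)).
    - intros k N. eapply Rle_trans; [apply Cmod_triangle|].
      rewrite Cmod_mult. replace (Cmod (-1)) with 1.
      + specialize (HB k N); specialize (Hbeta k); lra.
      + rewrite Cmod_R, Rabs_left; lra.
    - apply (ex_series_scal (V := R_NormedModule) 2 B SB).
    - intro k. replace (RtoC 0) with (beta k + (-1) * beta k)%C by ring.
      apply tends_plus; [apply Hb|apply tends_const]. }
  apply (tends_ext (fun N => (csum (fun k => (b k N + (-1) * beta k)%C) N + csum beta N)%C)).
  - intro N.
    assert (E : forall M, (csum (fun k => (b k N + (-1) * beta k)%C) M + csum beta M)%C
              = csum (fun k => b k N) M).
    { induction M as [|M IH].
      - rewrite !csum_0, ?rsum_0; ring.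
      - rewrite !csum_S, <- IH. ring. }
    apply E.
  - replace l with (0 + l)%C by ring. apply tends_plus; [exact V|exact Hl].
Qed.

(** * Absolute norm and evaluation of formal series *)

Lemma fmul_csum F G n : (F * G)%fps n = csum (fun i => F i * G (n - i)%nat)%C n.
Proof.
  revert F; induction n as [|n IH]; intro F.
  - rewrite csum_0; reflexivity.
  - rewrite fmul_S, csum_shift, IH. reflexivity.
Qed.

(** Stated through partial sums, to be usable before convergence is known. *)
Definition l1_le (F : fps) (M : R) : Prop :=
  forall N, rsum (fun n => Cmod (F n)) N <= M.

Lemma rsum_Cmod_ge0 (F : fps) N : 0 <= rsum (fun n => Cmod (F n)) N.
Proof.
  induction N as [|N IH]; [rewrite rsum_0; apply Cmod_ge_0|].
  rewrite rsum_S. pose proof (Cmod_ge_0 (F (S N))). lra.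
Qed.

Lemma l1_le_pos F M : l1_le F M -> 0 <= M.
Proof. intro H; exact (Rle_trans _ _ _ (rsum_Cmod_ge0 F O) (H O)). Qed.

Lemma l1_le_coef F M n : l1_le F M -> Cmod (F n) <= M.
Proof.
  intro H; refine (Rle_trans _ _ _ _ (H n)).
  destruct n as [|n]; [rewrite rsum_0; lra|].
  rewrite rsum_S. pose proof (rsum_Cmod_ge0 F n). lra.
Qed.

(** Separating the term [F 0] of the first factor reduces the bound to
    [ftail F]. *)
Lemma rsum_Cmod_mul N : forall F G : fps,
  rsum (fun n => Cmod ((F * G)%fps n)) N
    <= rsum (fun n => Cmod (F n)) N * rsum (fun n => Cmod (G n)) N.
Proof.
  induction N as [|N IH]; intros F G.
  - rewrite !rsum_0. unfold fmul; simpl. rewrite Cmod_mult; lra.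
  - rewrite (rsum_shift (fun n => Cmod ((F * G)%fps n))), (rsum_shift (fun n => Cmod (F n))).
    change (fun k => Cmod (F (S k))) with (fun k => Cmod (ftail F k)).
    assert (H : forall K, rsum (fun k => Cmod ((F * G)%fps (S k))) K
      <= Cmod (F O) * rsum (fun k => Cmod (G (S k))) K
         + rsum (fun k => Cmod ((ftail F * G)%fps k)) K).
    { induction K as [|K IHK].
      - rewrite !rsum_0, fmul_S. eapply Rle_trans; [apply Cmod_triangle|].
        rewrite Cmod_mult; lra.
      - rewrite !rsum_S, fmul_S.
        pose proof (Cmod_triangle (F O * G (S (S K)))%C ((ftail F * G)%fps (S K))) as T.
        rewrite Cmod_mult in T. lra. }
    specialize (H N). specialize (IH (ftail F) G).
    pose proof (rsum_Cmod_ge0 (ftail F) N) as P.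
    assert (Q : rsum (fun n => Cmod (G n)) N <= rsum (fun n => Cmod (G n)) (S N)).
    { rewrite rsum_S. pose proof (Cmod_ge_0 (G (S N))). lra. }
    rewrite (rsum_shift (fun n => Cmod (G n))) in *.
    unfold fmul at 1; cbn [fmul_coef]. rewrite Cmod_mult. nra.
Qed.

Lemma l1_le_mul F G M M' : l1_le F M -> l1_le G M' -> l1_le (F * G)%fps (M * M').
Proof.
  intros HF HG N. eapply Rle_trans; [apply rsum_Cmod_mul|].
  apply Rmult_le_compat; auto using rsum_Cmod_ge0.
Qed.

Lemma l1_le_one : l1_le (fconst 1) 1.
Proof.
  intro N; replace (rsum _ N) with 1; [lra|].
  induction N as [|N IH].
  - rewrite rsum_0; simpl. rewrite Cmod_1; reflexivity.
  - rewrite rsum_S, <- IH; simpl. rewrite Cmod_0; lra.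
Qed.

Lemma l1_le_pow F M k : l1_le F M -> l1_le (F ^ k)%fps (M ^ k).
Proof.
  intro H; induction k as [|k IH]; [exact l1_le_one|].
  exact (l1_le_mul _ _ _ _ H IH).
Qed.

(** Allowing the factor [2] for the sum of the powers of [1/2] makes every norm
    below follow from a bound of the coefficients. *)
Lemma l1_le_geom F K : (forall n, Cmod (F n) <= K * (1 / 2) ^ n) -> l1_le F (2 * K).
Proof.
  intros H N.
  assert (P : 0 <= K).
  { specialize (H O); simpl in H. pose proof (Cmod_ge_0 (F O)). lra. }
  enough (E : rsum (fun n => Cmod (F n)) N <= 2 * K - K * (1 / 2) ^ N).
  { pose proof (pow_le (1 / 2) N ltac:(lra)). nra. }
  induction N as [|N IH].
  - rewrite rsum_0. specialize (H O); simpl in *. lra.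
  - rewrite rsum_S. specialize (H (S N)). simpl in *. lra.
Qed.

Definition fscale (x : C) (F : fps) : fps := fun n => (F n * Cpow x n)%C.

(** Rescaling the variable by [x] turns the values and norms at [x] of a series
    into sums of coefficients. *)
Lemma fscale_mul x F G : fscale x (F * G)%fps = (fscale x F * fscale x G)%fps.
Proof.
  apply functional_extensionality; intro n; unfold fscale at 1.
  revert F; induction n as [|n IH]; intro F.
  - unfold fmul, fscale; simpl; ring.
  - rewrite !fmul_S.
    change (ftail (fscale x F)) with (fun n => ftail F n * (x * Cpow x n))%C.
    replace (fun n => ftail F n * (x * Cpow x n))%C with (fun n => x * fscale x (ftail F) n)%C
      by (apply functional_extensionality; intro k; unfold fscale; ring).
    rewrite fmul_const_coef, <- IH. unfold fscale. simpl. ring.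
Qed.

Lemma fscale_pow x F k : fscale x (F ^ k)%fps = (fscale x F ^ k)%fps.
Proof.
  induction k as [|k IH]; cbn [fpow].
  - apply functional_extensionality; intros [|n]; unfold fscale; simpl; ring.
  - rewrite fscale_mul, IH; reflexivity.
Qed.

Lemma fscale_fcomp x c F : fscale x (fcomp c F) = fcomp c (fscale x F).
Proof.
  apply functional_extensionality; intro n; unfold fscale at 1, fcomp.
  rewrite Cmult_comm. fold (csum (fun k => c k * (F ^ k)%fps n)%C n).
  rewrite <- csum_mul. apply csum_ext; intros k _.
  rewrite <- fscale_pow. unfold fscale. ring.
Qed.

Lemma csum_fscale_fconst z c N : csum (fscale z (fconst c)) N = c.
Proof.
  induction N as [|N IH].
  - rewrite csum_0; unfold fscale; simpl; ring.
  - rewrite csum_S, IH; unfold fscale; simpl; ring.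
Qed.

Lemma is_pseries_tends (c : nat -> C) (z l : C) :
  @is_pseries C_AbsRing C_NormedModule c z l <-> tends (csum (fscale z c)) l.
Proof.
  assert (E : fscale z c = (fun n => pow_n (K := C_Ring) z n * c n)%C).
  { apply functional_extensionality; intro n; unfold fscale.
    rewrite Cmult_comm. apply (f_equal (fun y => Cmult y (c n))).
    induction n as [|n IH]; [reflexivity|]. simpl. rewrite IH; reflexivity. }
  rewrite E. apply is_series_tends.
Qed.

Lemma C_PSeries_unique c z l : tends (csum (fscale z c)) l -> C_PSeries c z = l.
Proof.
  intro H. unfold C_PSeries.
  apply (@iota_unique C_AbsRing C_CompleteNormedModule).
  - intros y Hy. apply is_pseries_tends in Hy. exact (tends_unique _ _ _ Hy H).
  - apply is_pseries_tends, H.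
Qed.

Lemma l1_le_tends F M : l1_le F M -> exists l, tends (csum F) l /\ Cmod l <= M.
Proof.
  intro H.
  destruct (ex_series_tends F (fun n => Cmod (F n))) as [l Hl].
  - intro n; lra.
  - apply (ex_series_bounded _ M); [intro n; apply Cmod_ge_0|exact H].
  - exists l; split; [exact Hl|].
    replace l with (l - 0)%C by ring. apply (tends_Cmod_le _ _ _ _ Hl).
    intro n. replace (csum F n - 0)%C with (csum F n) by ring.
    eapply Rle_trans; [apply Cmod_sum|apply H].
Qed.

(** The partial sums of [F * G] are [sum_(i <= N) F i * (sum_(j <= N - i) G j)];
    apply [tannery]. *)
Lemma mertens F G M M' l m : l1_le F M -> l1_le G M' ->
  tends (csum F) l -> tends (csum G) m -> tends (csum (F * G)%fps) (l * m)%C.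
Proof.
  intros HF HG Hl Hm.
  destruct (tannery (fun i N => F i * csum G (N - i))%C (fun i => F i * m)%C
              (fun i => M' * Cmod (F i))) as [s [Hs Hs']].
  - intros i N. rewrite Cmod_mult, Rmult_comm.
    apply Rmult_le_compat_r; [apply Cmod_ge_0|].
    eapply Rle_trans; [apply Cmod_sum|apply HG].
  - apply (ex_series_scal (V := R_NormedModule) M').
    apply (ex_series_bounded _ M); [intro n; apply Cmod_ge_0|exact HF].
  - intro i. apply tends_scal, tends_shift, Hm.
  - replace (l * m)%C with s.
    + revert Hs'. apply tends_ext. intro N.
      (* Partial sums are products with [1 + X + X^2 + ...], so this is associativity. *)
      assert (P : forall K n, csum K n = ((fun _ => RtoC 1) * K)%fps n).
      { intros K n; rewrite fmul_comm, fmul_csum. apply csum_ext; intros; ring. }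
      rewrite (P (F * G)%fps), fmul_assoc, (fmul_comm _ F), <- fmul_assoc, fmul_csum.
      apply csum_ext; intros i _. rewrite P; reflexivity.
    + apply (tends_unique _ _ _ Hs). rewrite Cmult_comm.
      apply (tends_ext (fun N => m * csum F N)%C); [|apply tends_scal, Hl].
      intro N; rewrite <- csum_mul. apply csum_ext; intros; ring.
Qed.

Lemma tends_csum_pow F M l k : l1_le F M -> tends (csum F) l ->
  tends (csum (F ^ k)%fps) (Cpow l k).
Proof.
  intros HF Hl; induction k as [|k IH].
  - apply (tends_ext (fun _ => RtoC 1)); [|apply tends_const].
    intro N; induction N as [|N IH]; [rewrite csum_0; reflexivity|].
    rewrite csum_S, <- IH; simpl; ring.
  - exact (mertens _ _ _ _ _ _ HF (l1_le_pow F M k HF) Hl IH).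
Qed.

Lemma ex_series_radius c x : 0 <= x -> Rbar_lt (Finite x) (C_radius c) ->
  ex_series (fun n => Cmod (c n) * x ^ n).
Proof.
  intros P H. apply ex_pseries_R, CV_radius_inside.
  rewrite Rabs_pos_eq by exact P. exact H.
Qed.

(** Up to degree [N] the composite only involves the powers [F^k], [k <= N], so
    its partial sums are [sum_(k <= N) c k * (sum_(n <= N) (F^k) n)]; the inner
    sums tend to [l^k] and are bounded by [M^k]; apply [tannery]. *)
Lemma tends_csum_fcomp c F M l : F O = RtoC 0 -> l1_le F M ->
  Rbar_lt (Finite M) (C_radius c) -> tends (csum F) l ->
  tends (csum (fcomp c F)) (C_PSeries c l).
Proof.
  intros F0 HF HM Hl.
  destruct (tannery (fun k N => c k * csum (F ^ k)%fps N)%C (fun k => c k * Cpow l k)%C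
              (fun k => Cmod (c k) * M ^ k)) as [s [Hs Hs']].
  - intros k N. rewrite Cmod_mult.
    apply Rmult_le_compat_l; [apply Cmod_ge_0|].
    eapply Rle_trans; [apply Cmod_sum|apply l1_le_pow, HF].
  - apply ex_series_radius; [exact (l1_le_pos _ _ HF)|exact HM].
  - intro k. apply tends_scal, (tends_csum_pow F M); assumption.
  - rewrite (C_PSeries_unique c l s Hs). revert Hs'. apply tends_ext. intro N.
    transitivity (csum (fun n => csum (fun k => c k * (F ^ k)%fps n)%C N) N).
    + rewrite (csum_switch (fun n k => c k * (F ^ k)%fps n)%C).
      apply csum_ext; intros k _. rewrite csum_mul; reflexivity.
    + apply csum_ext; intros n Hn. symmetry; apply fcomp_trunc; assumption.
Qed.

(** * Derivatives relative to a segment *)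

(** First-order expansion: free of quotients and of the condition [x <> t], it
    makes the rules of calculus direct estimates. *)
Lemma is_deriv_on_eps a b f t l : is_deriv_on a b f t l <->
  forall eps, 0 < eps -> exists delta, 0 < delta /\
    forall x, segment a b x -> Rabs (x - t) < delta ->
      Cmod (f x - f t - RtoC (x - t) * l)%C <= eps * Rabs (x - t).
Proof.
  assert (Q : forall x, x <> t -> (f x - f t - RtoC (x - t) * l)%C
    = (RtoC (x - t) * ((f x - f t) / RtoC (x - t) - l))%C).
  { intros x Hx. field. intro E; apply RtoC_inj in E; lra. }
  unfold is_deriv_on; split.
  - intros H eps He.
    assert (Hs : 0 < sqrt 2) by (apply sqrt_lt_R0; lra).
    assert (He' : 0 < eps / sqrt 2) by (apply Rdiv_lt_0_compat; lra).
    destruct (proj1 (filterlim_locally _ _) H (mkposreal _ He')) as [d Hd].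
    exists d; split; [apply cond_pos|]. intros x Sx Hx.
    destruct (Req_dec x t) as [->|Nx].
    + replace (f t - f t - RtoC (t - t) * l)%C with (RtoC 0) by (rewrite Rminus_diag; ring).
      rewrite Cmod_0, Rminus_diag, Rabs_R0; lra.
    + specialize (Hd x Hx (conj Sx Nx)).
      apply C_NormedModule_mixin_compat2 in Hd. cbn [pos] in Hd.
      replace (sqrt 2 * (eps / sqrt 2)) with eps in Hd by (field; lra).
      rewrite Q, Cmod_mult, Cmod_R, Rmult_comm by exact Nx.
      apply Rmult_le_compat_r; [apply Rabs_pos|]. apply Rlt_le; exact Hd.
  - intro H. apply filterlim_locally; intro eps.
    destruct (H (eps / 2)) as [d [Hd Hx]]; [pose proof (cond_pos eps); lra|].
    exists (mkposreal d Hd); intros x Bx [Sx Nx].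
    apply C_NormedModule_mixin_compat1.
    specialize (Hx x Sx Bx).
    rewrite Q, Cmod_mult, Cmod_R, Rmult_comm in Hx by exact Nx.
    assert (P : 0 < Rabs (x - t)) by (apply Rabs_pos_lt; lra).
    apply Rmult_le_reg_r in Hx; [|exact P].
    pose proof (cond_pos eps).
    apply Rle_lt_trans with (2 := (ltac:(lra) : eps / 2 < eps)). exact Hx.
Qed.

(** A nondegenerate segment contains points arbitrarily close to, and distinct
    from, each of its points. *)
Lemma is_deriv_on_unique a b f t l m : a < b -> segment a b t ->
  is_deriv_on a b f t l -> is_deriv_on a b f t m -> l = m.
Proof.
  intros Hab [Ht1 Ht2] Hl Hm. rewrite is_deriv_on_eps in Hl, Hm.
  assert (Z : Cmod (l - m)%C <= 0).
  { apply Rnot_lt_le; intro P.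
    destruct (Hl (Cmod (l - m)%C / 3)) as [d [Hd Hdl]]; [lra|].
    destruct (Hm (Cmod (l - m)%C / 3)) as [d' [Hd' Hdm]]; [lra|].
    assert (X : exists x, segment a b x /\ 0 < Rabs (x - t) /\ Rabs (x - t) < Rmin d d').
    { assert (M : 0 < Rmin (Rmin d d') (b - a)) by (repeat apply Rmin_glb_lt; lra).
      pose proof (Rmin_l (Rmin d d') (b - a)). pose proof (Rmin_r (Rmin d d') (b - a)).
      set (h := Rmin (Rmin d d') (b - a) / 2) in *.
      assert (0 < h /\ h < Rmin d d' /\ h <= (b - a) / 2) as [h1 [h2 h3]]
        by (unfold h; lra).
      destruct (Rle_dec t ((a + b) / 2)).
      - exists (t + h). replace (t + h - t) with h by ring.
        rewrite Rabs_pos_eq by lra. unfold segment; lra.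
      - exists (t - h). replace (t - h - t) with (- h) by ring.
        rewrite Rabs_Ropp, Rabs_pos_eq by lra. unfold segment; lra. }
    destruct X as [x [Sx [X1 X2]]].
    pose proof (Rmin_l d d'); pose proof (Rmin_r d d').
    specialize (Hdl x Sx ltac:(lra)). specialize (Hdm x Sx ltac:(lra)).
    pose proof (Cmod_triangle (- (f x - f t - RtoC (x - t) * l))%C
                              (f x - f t - RtoC (x - t) * m)%C) as T.
    rewrite Cmod_opp in T.
    replace (- (f x - f t - RtoC (x - t) * l) + (f x - f t - RtoC (x - t) * m))%C
      with (RtoC (x - t) * (l - m))%C in T by ring.
    rewrite Cmod_mult, Cmod_R in T. nra. }
  pose proof (Cmod_ge_0 (l - m)%C).
  assert (E : (l - m)%C = 0) by (apply Cmod_eq_0; lra).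
  replace l with ((l - m) + m)%C by ring. rewrite E; ring.
Qed.

Lemma D_correct a b f t l : a < b -> segment a b t -> is_deriv_on a b f t l -> D a b f t = l.
Proof.
  intros Hab Ht H. apply (@iota_unique C_AbsRing C_CompleteNormedModule); [|exact H].
  intros y Hy; exact (is_deriv_on_unique a b f t y l Hab Ht Hy H).
Qed.

Lemma deriv_lipschitz a b f t l : is_deriv_on a b f t l ->
  exists delta, 0 < delta /\ forall x, segment a b x -> Rabs (x - t) < delta ->
    Cmod (f x - f t)%C <= (Cmod l + 1) * Rabs (x - t).
Proof.
  intro H; rewrite is_deriv_on_eps in H.
  destruct (H 1 Rlt_0_1) as [d [Hd Hx]]. exists d; split; [exact Hd|].
  intros x Sx Bx; specialize (Hx x Sx Bx).
  replace (f x - f t)%C with ((f x - f t - RtoC (x - t) * l) + RtoC (x - t) * l)%C by ring.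
  eapply Rle_trans; [apply Cmod_triangle|]. rewrite Cmod_mult, Cmod_R. lra.
Qed.

Lemma deriv_continuous a b f t l : is_deriv_on a b f t l -> forall eps, 0 < eps ->
  exists delta, 0 < delta /\ forall x, segment a b x -> Rabs (x - t) < delta ->
    Cmod (f x - f t)%C < eps.
Proof.
  intros H eps He. destruct (deriv_lipschitz a b f t l H) as [d [Hd Hx]].
  pose proof (Cmod_ge_0 l) as Pl.
  assert (He' : 0 < eps / (Cmod l + 1)) by (apply Rdiv_lt_0_compat; lra).
  exists (Rmin d (eps / (Cmod l + 1))); split; [apply Rmin_glb_lt; assumption|].
  intros x Sx Bx.
  pose proof (Rmin_l d (eps / (Cmod l + 1))). pose proof (Rmin_r d (eps / (Cmod l + 1))).
  specialize (Hx x Sx ltac:(lra)).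
  apply Rle_lt_trans with (1 := Hx). rewrite Rmult_comm.
  apply (Rlt_div_r _ eps (Cmod l + 1)); lra.
Qed.

Lemma deriv_const a b c t : is_deriv_on a b (fun _ => c) t 0.
Proof.
  apply is_deriv_on_eps; intros eps He; exists 1; split; [lra|]. intros x _ _.
  replace (c - c - RtoC (x - t) * 0)%C with (RtoC 0) by ring.
  rewrite Cmod_0. pose proof (Rabs_pos (x - t)). nra.
Qed.

Lemma deriv_plus a b f g t l m : is_deriv_on a b f t l -> is_deriv_on a b g t m ->
  is_deriv_on a b (fun x => f x + g x)%C t (l + m)%C.
Proof.
  rewrite !is_deriv_on_eps; intros Hf Hg eps He.
  destruct (Hf (eps / 2)) as [d [Hd Hdf]]; [lra|].
  destruct (Hg (eps / 2)) as [d' [Hd' Hdg]]; [lra|].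
  exists (Rmin d d'); split; [apply Rmin_glb_lt; assumption|]. intros x Sx Bx.
  pose proof (Rmin_l d d'). pose proof (Rmin_r d d').
  specialize (Hdf x Sx ltac:(lra)). specialize (Hdg x Sx ltac:(lra)).
  replace (f x + g x - (f t + g t) - RtoC (x - t) * (l + m))%C
    with ((f x - f t - RtoC (x - t) * l) + (g x - g t - RtoC (x - t) * m))%C by ring.
  eapply Rle_trans; [apply Cmod_triangle|]. lra.
Qed.

Lemma deriv_mult a b f g t l m : is_deriv_on a b f t l -> is_deriv_on a b g t m ->
  is_deriv_on a b (fun x => f x * g x)%C t (l * g t + f t * m)%C.
Proof.
  intros Hf Hg. apply is_deriv_on_eps; intros eps He.
  pose proof (Cmod_ge_0 l) as Pl. pose proof (Cmod_ge_0 (g t)) as Pg.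
  pose proof (Cmod_ge_0 (f t)) as Pf.
  assert (Pos : forall r, 0 <= r -> 0 < eps / (3 * (r + 1)))
    by (intros r Hr; apply Rdiv_lt_0_compat; lra).
  assert (Small : forall r, 0 <= r -> r * (eps / (3 * (r + 1))) <= eps / 3).
  { intros r Hr. apply Rle_trans with ((r + 1) * (eps / (3 * (r + 1)))).
    - apply Rmult_le_compat_r; [apply Rlt_le, Pos, Hr|lra].
    - apply Req_le; field; lra. }
  destruct (deriv_continuous a b g t m Hg _ (Pos _ Pl)) as [d2 [Hd2 H2]].
  destruct (deriv_continuous a b g t m Hg 1 Rlt_0_1) as [d4 [Hd4 H4]].
  rewrite is_deriv_on_eps in Hf, Hg.
  destruct (Hf _ (Pos _ Pg)) as [d1 [Hd1 H1]].
  destruct (Hg _ (Pos _ Pf)) as [d3 [Hd3 H3]].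
  exists (Rmin (Rmin d1 d2) (Rmin d3 d4)); split; [repeat apply Rmin_glb_lt; assumption|].
  intros x Sx Bx.
  pose proof (Rmin_l (Rmin d1 d2) (Rmin d3 d4)). pose proof (Rmin_r (Rmin d1 d2) (Rmin d3 d4)).
  pose proof (Rmin_l d1 d2). pose proof (Rmin_r d1 d2).
  pose proof (Rmin_l d3 d4). pose proof (Rmin_r d3 d4).
  specialize (H1 x Sx ltac:(lra)). specialize (H2 x Sx ltac:(lra)).
  specialize (H3 x Sx ltac:(lra)). specialize (H4 x Sx ltac:(lra)).
  assert (Gx : Cmod (g x) <= Cmod (g t) + 1).
  { replace (g x) with ((g x - g t) + g t)%C by ring.
    eapply Rle_trans; [apply Cmod_triangle|lra]. }
  replace (f x * g x - f t * g t - RtoC (x - t) * (l * g t + f t * m))%C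
    with ((f x - f t - RtoC (x - t) * l) * g x + RtoC (x - t) * (l * (g x - g t))
          + f t * (g x - g t - RtoC (x - t) * m))%C by ring.
  pose proof (Rabs_pos (x - t)) as Ph.
  eapply Rle_trans; [apply Cmod_triangle|].
  eapply Rle_trans; [apply Rplus_le_compat_r, Cmod_triangle|].
  rewrite !Cmod_mult, Cmod_R.
  assert (A1 : Cmod (f x - f t - RtoC (x - t) * l)%C * Cmod (g x) <= eps / 3 * Rabs (x - t)).
  { apply Rle_trans with (eps / (3 * (Cmod (g t) + 1)) * Rabs (x - t) * (Cmod (g t) + 1)).
    - apply Rmult_le_compat; auto using Cmod_ge_0.
    - apply Req_le; field; lra. }
  assert (A2 : Rabs (x - t) * (Cmod l * Cmod (g x - g t)%C) <= eps / 3 * Rabs (x - t)).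
  { rewrite Rmult_comm. apply Rmult_le_compat_r; [exact Ph|].
    eapply Rle_trans; [|apply (Small _ Pl)]. apply Rmult_le_compat_l; lra. }
  assert (A3 : Cmod (f t) * Cmod (g x - g t - RtoC (x - t) * m)%C <= eps / 3 * Rabs (x - t)).
  { apply Rle_trans with (Cmod (f t) * (eps / (3 * (Cmod (f t) + 1))) * Rabs (x - t)).
    - rewrite Rmult_assoc. apply Rmult_le_compat_l; assumption.
    - apply Rmult_le_compat_r; [exact Ph|apply Small, Pf]. }
  lra.
Qed.

Lemma deriv_scal a b c f t l : is_deriv_on a b f t l ->
  is_deriv_on a b (fun x => c * f x)%C t (c * l)%C.
Proof.
  intro H. replace (c * l)%C with (0 * f t + c * l)%C by ring.
  exact (deriv_mult a b (fun _ => c) f t 0 l (deriv_const a b c t) H).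
Qed.

Lemma deriv_csum a b (f : nat -> R -> C) t (l : nat -> C) N :
  (forall k, is_deriv_on a b (f k) t (l k)) ->
  is_deriv_on a b (fun x => csum (fun k => f k x) N) t (csum l N).
Proof.
  intro H; induction N as [|N IH].
  { rewrite csum_0. replace (fun x => csum (fun k => f k x) O) with (f O); [apply H|].
    apply functional_extensionality; intro x; rewrite csum_0; reflexivity. }
  rewrite csum_S.
  replace (fun x => csum (fun k => f k x) (S N))
    with (fun x => csum (fun k => f k x) N + f (S N) x)%C
    by (apply functional_extensionality; intro x; rewrite csum_S; reflexivity).
  apply deriv_plus; [exact IH|apply H].
Qed.

(** The composite [phi_t o g] only makes sense near [t].  Relatively open sets
    serve as domains: derivatives at their points, of any order, are determined
    by the values inside. *)
Definition rel_open (a b : R) (I : R -> Prop) : Prop := forall x, I x ->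
  segment a b x /\
  exists delta, 0 < delta /\ forall y, segment a b y -> Rabs (y - x) < delta -> I y.

Lemma deriv_ext a b I f g t l : rel_open a b I -> I t -> (forall x, I x -> f x = g x) ->
  is_deriv_on a b f t l -> is_deriv_on a b g t l.
Proof.
  intros HI It E. rewrite !is_deriv_on_eps; intros H eps He.
  destruct (H eps He) as [d [Hd Hx]]. destruct (HI t It) as [_ [d' [Hd' Hy]]].
  exists (Rmin d d'); split; [apply Rmin_glb_lt; assumption|]. intros x Sx Bx.
  pose proof (Rmin_l d d'). pose proof (Rmin_r d d').
  rewrite <- (E x), <- (E t) by (first [assumption | apply Hy; [assumption|lra]]).
  apply Hx; [assumption|lra].
Qed.

(** * Taylor families *)

Definition fderiv (a b : R) (F : R -> fps) (x : R) (F' : fps) : Prop :=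
  forall p, is_deriv_on a b (fun y => F y p) x (F' p).

(** The equation [d/dx F x = F x '], true of Taylor series: the coefficients
    [f^(p) / p!] of [f] satisfy [(f^(p) / p!)' = (p + 1) f^(p+1) / (p + 1)!].
    In this form the Leibniz formula for higher derivatives is just the fact
    that both sides are derivations. *)
Definition taylor (a b : R) (I : R -> Prop) (F : R -> fps) : Prop :=
  forall x, I x -> fderiv a b F x (fder (F x)).

Lemma fderiv_mul a b F G x F' G' : fderiv a b F x F' -> fderiv a b G x G' ->
  fderiv a b (fun y => F y * G y)%fps x (F' * G x + F x * G')%fps.
Proof.
  intros HF HG p. revert F F' HF; induction p as [|p IH]; intros F F' HF.
  - exact (deriv_mult a b _ _ x _ _ (HF O) (HG O)).
  - rewrite fadd_coef, !fmul_S.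
    replace (F' O * G x (S p) + (ftail F' * G x)%fps p
             + (F x O * G' (S p) + (ftail (F x) * G')%fps p))%C
      with ((F' O * G x (S p) + F x O * G' (S p))
            + ((ftail F' * G x)%fps p + (ftail (F x) * G')%fps p))%C by ring.
    apply (deriv_plus a b (fun y => F y O * G y (S p))%C (fun y => (ftail (F y) * G y)%fps p)).
    + exact (deriv_mult a b _ _ x _ _ (HF O) (HG (S p))).
    + rewrite <- fadd_coef. apply (IH (fun y => ftail (F y)) (ftail F')).
      intro q; exact (HF (S q)).
Qed.

Lemma fderiv_const a b F x : fderiv a b (fun _ => F) x (fconst 0).
Proof.
  intro p. replace (fconst 0 p) with (RtoC 0) by (destruct p; reflexivity).
  apply deriv_const.
Qed.

Lemma fderiv_fconst a b h x l : is_deriv_on a b h x l ->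
  fderiv a b (fun y => fconst (h y)) x (fconst l).
Proof. intros H [|p]; [exact H|exact (deriv_const a b 0 x)]. Qed.

Lemma fderiv_sub a b F G x F' G' : fderiv a b F x F' -> fderiv a b G x G' ->
  fderiv a b (fun y => F y - G y)%fps x (F' - G')%fps.
Proof.
  intros HF HG p. unfold fsub, fadd, fopp. apply deriv_plus; [apply HF|].
  replace (- G' p)%C with ((-1) * G' p)%C by ring.
  replace (fun y => - G y p)%C with (fun y => (-1) * G y p)%C
    by (apply functional_extensionality; intro y; ring).
  apply deriv_scal, HG.
Qed.

Lemma fderiv_pow a b F x F' k : fderiv a b F x F' ->
  fderiv a b (fun y => F y ^ S k)%fps x (fconst (RtoC (INR (S k))) * (F x ^ k * F'))%fps.
Proof.
  intro H; induction k as [|k IH].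
  - replace (fconst (RtoC (INR 1)) * (F x ^ 0 * F'))%fps
      with (F' * fconst 1 + F x * fconst 0)%fps.
    + exact (fderiv_mul a b F (fun _ => fconst 1) x _ _ H (fderiv_const a b _ x)).
    + change (fconst (RtoC (INR 1))) with (fconst 1). ring.
  - replace (fconst (RtoC (INR (S (S k)))) * (F x ^ S k * F'))%fps
      with (F' * F x ^ S k + F x * (fconst (RtoC (INR (S k))) * (F x ^ k * F')))%fps.
    + exact (fderiv_mul a b F (fun y => F y ^ S k)%fps x _ _ H IH).
    + rewrite (fconst_INR_S (S k)). cbn [fpow]. ring.
Qed.

Lemma taylor_mul a b I F G : taylor a b I F -> taylor a b I G ->
  taylor a b I (fun x => F x * G x)%fps.
Proof. intros HF HG x Ix. rewrite fder_mul. apply fderiv_mul; auto. Qed.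

Lemma taylor_pow a b I F k : taylor a b I F -> taylor a b I (fun x => F x ^ k)%fps.
Proof.
  intro HF; induction k as [|k IH].
  - intros x Ix. cbn [fpow]. rewrite fder_const. apply fderiv_const.
  - exact (taylor_mul a b I F _ HF IH).
Qed.

Lemma taylor_fder a b I F : taylor a b I F -> taylor a b I (fun x => fder (F x)).
Proof. intros HF x Ix p. apply deriv_scal, HF, Ix. Qed.

(** Induction on [p]: [F x (p + 1)] is determined by the derivative of
    [F x p]. *)
Lemma taylor_Diter a b I F f : a < b -> rel_open a b I -> taylor a b I F ->
  (forall x, I x -> f x = F x O) ->
  forall p x, I x -> Diter a b p f x = (RtoC (INR (fact p)) * F x p)%C.
Proof.
  intros Hab HI HF E; induction p as [|p IH]; intros x Ix.
  - simpl. rewrite (E x Ix). ring.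
  - change (Diter a b (S p) f x) with (D a b (Diter a b p f) x).
    apply D_correct; [exact Hab|apply (HI x Ix)|].
    apply (deriv_ext a b I (fun y => RtoC (INR (fact p)) * F y p)%C); try assumption.
    + intros y Iy; symmetry; exact (IH y Iy).
    + replace (RtoC (INR (fact (S p))) * F x (S p))%C
        with (RtoC (INR (fact p)) * fder (F x) p)%C.
      * apply deriv_scal, HF, Ix.
      * unfold fder. change (fact (S p)) with (S p * fact p)%nat.
        rewrite mult_INR, RtoC_mult. ring.
Qed.

Definition taylor_of (a b : R) (f : R -> C) (x : R) : fps :=
  fun p => (RtoC (/ INR (fact p)) * Diter a b p f x)%C.

Lemma taylor_smooth a b f I : a < b -> rel_open a b I -> smooth_on a b f ->
  taylor a b I (taylor_of a b f).
Proof.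
  intros Hab HI Hf x Ix p. destruct (HI x Ix) as [Sx _].
  destruct (Hf p x Sx) as [l Hl].
  replace (fder (taylor_of a b f x) p) with (RtoC (/ INR (fact p)) * l)%C.
  - apply deriv_scal, Hl.
  - unfold fder, taylor_of.
    change (Diter a b (S p) f x) with (D a b (Diter a b p f) x).
    rewrite (D_correct _ _ _ _ _ Hab Sx Hl).
    rewrite Cmult_assoc, <- RtoC_mult. do 2 f_equal.
    change (fact (S p)) with (S p * fact p)%nat. rewrite mult_INR.
    field; split; [apply INR_fact_neq_0|apply not_0_INR; lia].
Qed.

(** * Differentiation of complex power series *)

Lemma C_radius_fder c : C_radius (fder c) = C_radius c.
Proof.
  unfold C_radius. rewrite <- (CV_radius_derive (fun n => Cmod (c n))).
  apply CV_radius_ext; intro n. unfold fder, PS_derive.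
  rewrite Cmod_mult, Cmod_R, Rabs_pos_eq by apply pos_INR. reflexivity.
Qed.

Lemma Rbar_lt_between x (y : Rbar) : Rbar_lt (Finite x) y ->
  exists r, x < r /\ Rbar_lt (Finite r) y.
Proof.
  destruct y as [y| |]; simpl; intro H.
  - exists ((x + y) / 2); split; lra.
  - exists (x + 1); split; [lra|exact I].
  - contradiction.
Qed.

Lemma C_PSeries_tends c w : Rbar_lt (Finite (Cmod w)) (C_radius c) ->
  tends (csum (fscale w c)) (C_PSeries c w).
Proof.
  intro H.
  destruct (ex_series_tends (fscale w c) (fun n => Cmod (c n) * Cmod w ^ n)) as [l Hl].
  - intro n; unfold fscale. rewrite Cmod_mult, Cmod_pow; lra.
  - apply ex_series_radius; [apply Cmod_ge_0|exact H].
  - rewrite (C_PSeries_unique c w l Hl). exact Hl.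
Qed.

Lemma C_PSeries_0 c : C_PSeries c 0 = c O.
Proof.
  apply C_PSeries_unique. apply (tends_ext (fun _ => c O)); [|apply tends_const].
  intro N; induction N as [|N IH].
  - rewrite csum_0; unfold fscale; simpl; ring.
  - rewrite csum_S, <- IH; unfold fscale; simpl; ring.
Qed.

Lemma Cpow_second_order w w0 r n : Cmod w <= r -> Cmod w0 <= r ->
  Cmod (Cpow w (S (S n)) - Cpow w0 (S (S n))
        - (w - w0) * (RtoC (INR (S (S n))) * Cpow w0 (S n)))%C
    <= INR (S n) * INR (S (S n)) * r ^ n * Cmod (w - w0)%C ^ 2.
Proof.
  intros Hw Hw0; induction n as [|n IH].
  - replace (Cpow w 2 - Cpow w0 2 - (w - w0) * (RtoC (INR 2) * Cpow w0 1))%C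
      with (Cpow (w - w0) 2).
    + rewrite Cmod_pow. pose proof (pow2_ge_0 (Cmod (w - w0)%C)). simpl INR. simpl pow at 2. nra.
    + simpl INR. rewrite RtoC_plus. simpl. ring.
  - replace (Cpow w (S (S (S n))) - Cpow w0 (S (S (S n)))
        - (w - w0) * (RtoC (INR (S (S (S n)))) * Cpow w0 (S (S n))))%C
      with (w * (Cpow w (S (S n)) - Cpow w0 (S (S n))
              - (w - w0) * (RtoC (INR (S (S n))) * Cpow w0 (S n)))
            + RtoC (INR (S (S n))) * Cpow w0 (S n) * Cpow (w - w0) 2)%C.
    + eapply Rle_trans; [apply Cmod_triangle|].
      rewrite !Cmod_mult, (Cmod_pow w0), (Cmod_pow (w - w0)%C), Cmod_R,
        Rabs_pos_eq by apply pos_INR.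
      pose proof (pow2_ge_0 (Cmod (w - w0)%C)) as Pd.
      pose proof (Cmod_ge_0 w) as Pw. pose proof (Cmod_ge_0 w0) as Pw0.
      assert (Pr : 0 <= r) by lra.
      assert (A : Cmod w * Cmod (Cpow w (S (S n)) - Cpow w0 (S (S n))
              - (w - w0) * (RtoC (INR (S (S n))) * Cpow w0 (S n)))%C
        <= r * (INR (S n) * INR (S (S n)) * r ^ n * Cmod (w - w0)%C ^ 2))
        by (apply Rmult_le_compat; auto using Cmod_ge_0).
      assert (B : INR (S (S n)) * Cmod w0 ^ S n * Cmod (w - w0)%C ^ 2
        <= INR (S (S n)) * r ^ S n * Cmod (w - w0)%C ^ 2).
      { apply Rmult_le_compat_r; [exact Pd|].
        apply Rmult_le_compat_l; [apply pos_INR|]. apply pow_incr; lra. }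
      eapply Rle_trans; [apply Rplus_le_compat; [exact A|exact B]|].
      rewrite (S_INR (S (S n))), (S_INR (S n)), (S_INR n).
      replace (r ^ S n) with (r * r ^ n) by reflexivity.
      pose proof (pow_le r n Pr) as Prn. pose proof (pos_INR n) as Pn.
      assert (Q : 0 <= r * r ^ n * Cmod (w - w0)%C ^ 2)
        by exact (Rmult_le_pos _ _ (Rmult_le_pos _ _ Pr Prn) Pd).
      nra.
    + rewrite (S_INR (S (S n))), RtoC_plus. simpl Cpow. ring.
Qed.

Lemma tends_skip u l k : tends u l -> tends (fun n => u (n + k)%nat) l.
Proof.
  intros H eps He; destruct (H eps He) as [N HN].
  exists N; intros n Hn; apply HN; lia.
Qed.

(** Termwise application of [Cpow_second_order]; the resulting constant is the
    sum of the second derived series at [r], which has the same radius. *)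
Lemma C_PSeries_second_order c r : Rbar_lt (Finite r) (C_radius c) -> 0 <= r ->
  exists K, 0 <= K /\ forall w w0, Cmod w <= r -> Cmod w0 <= r ->
    Cmod (C_PSeries c w - C_PSeries c w0 - (w - w0) * C_PSeries (fder c) w0)%C
      <= K * Cmod (w - w0)%C ^ 2.
Proof.
  intros Hr Pr.
  assert (Q : forall n, Cmod (fder (fder c) n) * r ^ n
    = INR (S n) * INR (S (S n)) * r ^ n * Cmod (c (S (S n)))).
  { intro n. unfold fder. rewrite !Cmod_mult, !Cmod_R, !Rabs_pos_eq by apply pos_INR. ring. }
  assert (X : exists K, forall N, rsum (fun n => Cmod (fder (fder c) n) * r ^ n) N <= K).
  { assert (E : ex_series (fun n => Cmod (fder (fder c) n) * r ^ n))
      by (apply ex_series_radius; [exact Pr|rewrite !C_radius_fder; exact Hr]).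
    exists (Series (fun n => Cmod (fder (fder c) n) * r ^ n)). intro N.
    apply (is_lim_seq_incr_compare (sum_n (fun n => Cmod (fder (fder c) n) * r ^ n))).
    - exact (Series_correct _ E).
    - intro n. rewrite sum_Sn. unfold plus; simpl.
      pose proof (Rmult_le_pos _ _ (Cmod_ge_0 (fder (fder c) (S n))) (pow_le r (S n) Pr)).
      simpl in *; lra. }
  destruct X as [K HK]. exists K; split.
  { refine (Rle_trans _ _ _ _ (HK O)). rewrite rsum_0. simpl.
    pose proof (Cmod_ge_0 (fder (fder c) O)); lra. }
  intros w w0 Hw Hw0.
  assert (R1 : forall v, Cmod v <= r -> Rbar_lt (Finite (Cmod v)) (C_radius c))
    by (intros v Hv; exact (Rbar_le_lt_trans (Finite _) (Finite r) _ Hv Hr)).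
  pose proof (C_PSeries_tends c w (R1 w Hw)) as T1.
  pose proof (C_PSeries_tends c w0 (R1 w0 Hw0)) as T2.
  assert (T3 : tends (csum (fscale w0 (fder c))) (C_PSeries (fder c) w0))
    by (apply C_PSeries_tends; rewrite C_radius_fder; exact (R1 w0 Hw0)).
  apply (tends_skip _ _ 2) in T1. apply (tends_skip _ _ 2), (tends_scal (-1)) in T2.
  apply (tends_skip _ _ 1), (tends_scal (- (w - w0))%C) in T3.
  pose proof (tends_plus _ _ _ _ (tends_plus _ _ _ _ T1 T2) T3) as T.
  match type of T with tends ?u ?l => set (v := u) in T;
    replace (C_PSeries c w - C_PSeries c w0 - (w - w0) * C_PSeries (fder c) w0)%C
      with (l - 0)%C by ring end.
  apply (tends_Cmod_le _ _ _ _ T). intro n. subst v. cbv beta.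
  match goal with |- Cmod ?x <= _ => set (d := x) end.
  apply Rle_trans with (rsum (fun n => Cmod (fder (fder c) n) * r ^ n) n
                        * Cmod (w - w0)%C ^ 2).
  2: { apply Rmult_le_compat_r; [apply pow2_ge_0|apply HK]. }
  assert (Step : forall k, Cmod (c (S (S k)) * (Cpow w (S (S k)) - Cpow w0 (S (S k))
        - (w - w0) * (RtoC (INR (S (S k))) * Cpow w0 (S k))))%C
      <= Cmod (fder (fder c) k) * r ^ k * Cmod (w - w0)%C ^ 2).
  { intro k. rewrite Cmod_mult, Q.
    pose proof (Cpow_second_order w w0 r k Hw Hw0) as S2.
    pose proof (Rmult_le_compat_l _ _ _ (Cmod_ge_0 (c (S (S k)))) S2). lra. }
  subst d. induction n as [|n IH].
  - change (0 + 2)%nat with 2%nat. change (0 + 1)%nat with 1%nat. rewrite rsum_0, !csum_S, !csum_0.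
    refine (Rle_trans _ _ _ _ (Step O)). apply Req_le, f_equal.
    unfold fscale, fder. simpl. rewrite RtoC_plus. ring.
  - rewrite rsum_S, Rmult_plus_distr_r.
    refine (Rle_trans _ _ _ _ (Rplus_le_compat _ _ _ _ IH (Step (S n)))).
    eapply Rle_trans; [|apply Cmod_triangle]. apply Req_le, f_equal.
    replace (S n + 2)%nat with (S (S (S n))) by lia. replace (n + 2)%nat with (S (S n)) by lia.
    replace (S n + 1)%nat with (S (S n)) by lia. replace (n + 1)%nat with (S n) by lia.
    rewrite !(csum_S _ (S (S n))), !(csum_S (fscale w0 (fder c)) (S n)).
    set (s1 := csum (fscale w c) (S (S n))). set (s2 := csum (fscale w0 c) (S (S n))).
    set (s3 := csum (fscale w0 (fder c)) (S n)).
    unfold fscale, fder. cbn [Cpow]. ring.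
Qed.

Lemma deriv_C_PSeries a b c g w0 x l :
  is_deriv_on a b g x l -> Rbar_lt (Finite (Cmod (g x - w0)%C)) (C_radius c) ->
  is_deriv_on a b (fun y => C_PSeries c (g y - w0)%C) x (C_PSeries (fder c) (g x - w0)%C * l)%C.
Proof.
  intros Hg Hx. destruct (Rbar_lt_between _ _ Hx) as [r [Hr1 Hr2]].
  pose proof (Cmod_ge_0 (g x - w0)%C) as P0.
  destruct (C_PSeries_second_order c r Hr2 ltac:(lra)) as [K [HK HKw]].
  apply is_deriv_on_eps; intros eps He.
  set (P' := C_PSeries (fder c) (g x - w0)%C).
  pose proof (Cmod_ge_0 P') as PP. pose proof (Cmod_ge_0 l) as Pl.
  destruct (deriv_continuous a b g x l Hg (r - Cmod (g x - w0)%C)) as [d1 [Hd1 H1]]; [lra|].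
  destruct (deriv_lipschitz a b g x l Hg) as [d2 [Hd2 H2]].
  rewrite is_deriv_on_eps in Hg.
  destruct (Hg (eps / (2 * (Cmod P' + 1)))) as [d3 [Hd3 H3]]; [apply Rdiv_lt_0_compat; lra|].
  set (c2 := K * (Cmod l + 1) ^ 2).
  assert (Pc2 : 0 <= c2) by (apply Rmult_le_pos; [exact HK|apply pow2_ge_0]).
  assert (Hd4 : 0 < eps / (2 * (c2 + 1))) by (apply Rdiv_lt_0_compat; lra).
  set (d4 := eps / (2 * (c2 + 1))) in *.
  exists (Rmin (Rmin d1 d2) (Rmin d3 d4)); split; [repeat apply Rmin_glb_lt; assumption|].
  intros y Sy By.
  pose proof (Rmin_l (Rmin d1 d2) (Rmin d3 d4)). pose proof (Rmin_r (Rmin d1 d2) (Rmin d3 d4)).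
  pose proof (Rmin_l d1 d2). pose proof (Rmin_r d1 d2).
  pose proof (Rmin_l d3 d4). pose proof (Rmin_r d3 d4).
  specialize (H1 y Sy ltac:(lra)). specialize (H2 y Sy ltac:(lra)).
  specialize (H3 y Sy ltac:(lra)).
  assert (Gy : Cmod (g y - w0)%C <= r).
  { replace (g y - w0)%C with ((g y - g x) + (g x - w0))%C by ring.
    eapply Rle_trans; [apply Cmod_triangle|lra]. }
  specialize (HKw (g y - w0)%C (g x - w0)%C Gy ltac:(lra)). fold P' in HKw.
  replace (g y - w0 - (g x - w0))%C with (g y - g x)%C in HKw by ring.
  replace (C_PSeries c (g y - w0) - C_PSeries c (g x - w0) - RtoC (y - x) * (P' * l))%C
    with ((C_PSeries c (g y - w0) - C_PSeries c (g x - w0) - (g y - g x) * P')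
          + P' * (g y - g x - RtoC (y - x) * l))%C by ring.
  eapply Rle_trans; [apply Cmod_triangle|]. rewrite (Cmod_mult P').
  pose proof (Rabs_pos (y - x)) as Ph.
  assert (A1 : K * Cmod (g y - g x)%C ^ 2 <= eps / 2 * Rabs (y - x)).
  { apply Rle_trans with (c2 * Rabs (y - x) * Rabs (y - x)).
    - unfold c2. apply Rle_trans with (K * ((Cmod l + 1) * Rabs (y - x)) ^ 2).
      + apply Rmult_le_compat_l; [exact HK|]. apply pow_incr; split; [apply Cmod_ge_0|exact H2].
      + apply Req_le; ring.
    - apply Rmult_le_compat_r; [exact Ph|].
      apply Rle_trans with ((c2 + 1) * d4).
      + apply Rmult_le_compat; lra.
      + unfold d4; apply Req_le; field; lra. }
  assert (A2 : Cmod P' * Cmod (g y - g x - RtoC (y - x) * l)%C <= eps / 2 * Rabs (y - x)).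
  { apply Rle_trans with ((Cmod P' + 1) * (eps / (2 * (Cmod P' + 1)) * Rabs (y - x))).
    - apply Rmult_le_compat; auto using Cmod_ge_0; lra.
    - apply Req_le; field; lra. }
  lra.
Qed.

(** * Taylor families of composites *)

(** [psi^(k) (w) / k!], where [psi] is the sum of the series [c]. *)
Definition ps_taylor (c : nat -> C) (w : C) : nat -> C :=
  fun k => (RtoC (/ INR (fact k)) * C_PSeries (Nat.iter k fder c) w)%C.

Lemma iter_fder_coef c k : forall n,
  (RtoC (INR (fact n)) * Nat.iter k fder c n)%C = (RtoC (INR (fact (n + k))) * c (n + k)%nat)%C.
Proof.
  induction k as [|k IH]; intro n.
  - rewrite Nat.add_0_r; reflexivity.
  - change (Nat.iter (S k) fder c n) with (RtoC (INR (S n)) * Nat.iter k fder c (S n))%C.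
    rewrite Cmult_assoc, <- RtoC_mult, <- mult_INR.
    replace (fact n * S n)%nat with (fact (S n)) by (simpl; ring).
    rewrite IH. replace (S n + k)%nat with (n + S k)%nat by lia. reflexivity.
Qed.

Lemma ps_taylor_0 c : ps_taylor c 0 = c.
Proof.
  apply functional_extensionality; intro k. unfold ps_taylor. rewrite C_PSeries_0.
  replace (Nat.iter k fder c O) with (RtoC (INR (fact k)) * c k)%C.
  - rewrite Cmult_assoc, <- RtoC_mult, Rinv_l by apply INR_fact_neq_0. ring.
  - pose proof (iter_fder_coef c k O) as E. cbn [Nat.add] in E. rewrite <- E. simpl. ring.
Qed.

Lemma deriv_ps_taylor a b c g w0 x l k :
  is_deriv_on a b g x l -> Rbar_lt (Finite (Cmod (g x - w0)%C)) (C_radius c) ->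
  is_deriv_on a b (fun y => ps_taylor c (g y - w0)%C k) x
    (RtoC (INR (S k)) * ps_taylor c (g x - w0)%C (S k) * l)%C.
Proof.
  intros Hg Hx. unfold ps_taylor.
  replace (RtoC (INR (S k)) * (RtoC (/ INR (fact (S k))) *
             C_PSeries (Nat.iter (S k) fder c) (g x - w0)) * l)%C
    with (RtoC (/ INR (fact k)) * (C_PSeries (fder (Nat.iter k fder c)) (g x - w0) * l))%C.
  - apply deriv_scal, deriv_C_PSeries; [exact Hg|].
    replace (C_radius (Nat.iter k fder c)) with (C_radius c); [exact Hx|].
    clear; induction k as [|k IH]; [reflexivity|]. simpl. rewrite C_radius_fder; exact IH.
  - rewrite !Cmult_assoc, <- RtoC_mult. do 3 f_equal.
    change (fact (S k)) with (S k * fact k)%nat. rewrite mult_INR.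
    field; split; [apply INR_fact_neq_0|apply not_0_INR; lia].
Qed.

(** With [psi] the sum of [c], the Taylor series of [psi (f - w0)] at [x] is
    that of [psi] at [f x - w0] composed with that of [f] without its constant
    term.  Differentiating
    it in [x] moves both the centre [f x - w0] and the increment; the contributions
    of the moving centre cancel and the formal derivative remains. *)
Lemma taylor_C_PSeries a b I F c w0 : taylor a b I F ->
  (forall x, I x -> Rbar_lt (Finite (Cmod (F x O - w0)%C)) (C_radius c)) ->
  taylor a b I (fun x => fcomp (ps_taylor c (F x O - w0)%C) (F x - fconst (F x O))%fps).
Proof.
  intros HF HI x Ix p.
  set (G := fun y => (F y - fconst (F y O))%fps).
  set (d := fun y => ps_taylor c (F y O - w0)%C).
  change (is_deriv_on a b (fun y => fcomp (d y) (G y) p) x (fder (fcomp (d x) (G x)) p)).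
  assert (G0 : forall y, G y O = RtoC 0)
    by (intro y; unfold G, fsub, fadd, fopp; simpl; ring).
  set (F' := fder (F x) O).
  assert (HG : fderiv a b G x (fder (F x) - fconst F')%fps).
  { apply fderiv_sub; [exact (HF x Ix)|]. apply fderiv_fconst, (HF x Ix O). }
  assert (HG' : fder (G x) = fder (F x)).
  { apply functional_extensionality; intro i. unfold fder, G, fsub, fadd, fopp.
    cbn [fconst]. ring. }
  rewrite <- HG' in HG.
  set (G'k := fun k => match k with
    | O => fconst 0
    | S j => (fconst (RtoC (INR (S j))) * (G x ^ j * (fder (G x) - fconst F')))%fps end).
  assert (HGk : forall k, fderiv a b (fun y => G y ^ k)%fps x (G'k k)).
  { intros [|j]; [exact (fderiv_const a b (fconst 1) x)|]. apply fderiv_pow, HG. }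
  set (term := fun k => (RtoC (INR (S k)) * d x (S k) * F' * (G x ^ k)%fps p
                         + d x k * G'k k p)%C).
  assert (HD : is_deriv_on a b (fun y => fcomp (d y) (G y) p) x (csum term (S p))).
  { replace (fun y => fcomp (d y) (G y) p)
      with (fun y => csum (fun k => d y k * (G y ^ k)%fps p)%C (S p))
      by (apply functional_extensionality; intro y; symmetry;
          apply fcomp_trunc; [apply G0|lia]).
    apply (deriv_csum a b (fun k y => d y k * (G y ^ k)%fps p)%C). intro k.
    apply (deriv_mult a b (fun y => d y k)); [|apply HGk].
    apply (deriv_ps_taylor a b c (fun y => F y O)); [apply (HF x Ix O)|apply HI, Ix]. }
  (* The boundary term below vanishes for [N = p + 1], as [G x ^ N] starts in degree [N]. *)
  assert (Tele : forall N, csum term N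
    = (RtoC (INR (S N)) * d x (S N) * F' * (G x ^ N)%fps p
       + csum (fun k => d x k * fder (G x ^ k)%fps p)%C N)%C).
  { induction N as [|N IH].
    - rewrite !csum_0. unfold term. cbn [G'k fpow]. rewrite fder_const. reflexivity.
    - rewrite csum_S, IH, (csum_S (fun k => d x k * fder (G x ^ k)%fps p)%C), fder_pow.
      unfold term, G'k.
      replace (fconst (RtoC (INR (S N))) * (G x ^ N * (fder (G x) - fconst F')))%fps
        with (fconst (RtoC (INR (S N))) * (G x ^ N * fder (G x))
              + fconst (RtoC (INR (S N))) * (fconst (- F')%C * G x ^ N))%fps.
      + rewrite fadd_coef, !fmul_const. ring.
      + replace (fconst (- F')%C) with (- fconst F')%fps; [ring|].
        apply functional_extensionality; intros [|i]; unfold fopp; simpl; ring. }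
  replace (fder (fcomp (d x) (G x)) p) with (csum term (S p)); [exact HD|].
  rewrite Tele, (fpow_low (G x) (S p) (G0 x) p) by lia.
  unfold fder, fcomp. rewrite <- csum_mul.
  replace (RtoC (INR (S (S p))) * d x (S (S p)) * F' * 0)%C with (RtoC 0) by ring.
  rewrite Cplus_0_l. apply csum_ext; intros k _. ring.
Qed.

(** * From functions to formal series *)

(** [U x ^ n * fder (H x)] is a Taylor family for [u^n D h], so the iterated
    derivative in the definition is a coefficient of it, up to a factorial. *)
Lemma lagrange_coef_taylor a b I u h U H t n : a < b -> rel_open a b I ->
  taylor a b I U -> (forall x, I x -> u x = U x O) ->
  taylor a b I H -> (forall x, I x -> h x = H x O) -> I t ->
  lagrange_coef a b u h t n = lagrange (U t) (H t) n.
Proof.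
  intros Hab HI HU Eu HH Eh It. unfold lagrange_coef. destruct n as [|m].
  - rewrite lagrange_coef_0. simpl. rewrite (Eh t It), Rinv_1. ring.
  - cbn [lagrange_term].
    rewrite (taylor_Diter a b I (fun x => U x ^ S m * fder (H x))%fps _ Hab HI).
    + rewrite <- lagrange_coef_S, !Cmult_assoc, <- !RtoC_mult.
      replace (/ INR (fact (S m)) * INR (fact m) * INR (S m)) with 1; [ring|].
      change (fact (S m)) with (S m * fact m)%nat. rewrite mult_INR.
      field; split; [apply INR_fact_neq_0|apply not_0_INR; lia].
    + apply taylor_mul; [apply taylor_pow, HU|apply taylor_fder, HH].
    + intros x Ix.
      change (D a b h x) with (Diter a b 1 h x).
      rewrite (taylor_Diter a b I H h Hab HI HH Eh 1 x Ix), (Eu x Ix).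
      unfold fmul at 1. cbn [fmul_coef].
      rewrite <- fpow_0_coef. unfold fder. simpl. ring.
    + exact It.
Qed.

(** In particular the supremum defining the level is finite, so that passing
    to [real] loses nothing. *)
Lemma of_level_bound a b r f : a < b -> 0 < r -> of_level a b r f ->
  0 <= real (levelN a b r f) /\ levelN a b r f = Finite (real (levelN a b r f)) /\
  forall x p, segment a b x -> Cmod (taylor_of a b f x p) <= real (levelN a b r f) * r ^ p.
Proof.
  intros Hab Hr [_ HL].
  set (q := fun p => INR (fact p) * r ^ p).
  assert (Pq : forall p, 0 < q p)
    by (intro p; apply Rmult_lt_0_compat; [apply INR_fact_lt_0|apply pow_lt, Hr]).
  assert (UB : forall p x, segment a b x ->
    Rbar_le (Finite (Cmod (Diter a b p f x) / q p)) (levelN a b r f)).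
  { intros p x Sx. apply (Sup_seq_minor_le _ _ p). fold (q p).
    assert (L : Rbar_le (Finite (Cmod (Diter a b p f x))) (supnorm a b (Diter a b p f))).
    { unfold supnorm.
      apply (proj1 (Lub_Rbar_correct
        (fun y => exists t, segment a b t /\ y = Cmod (Diter a b p f t)))).
      exists x; split; [exact Sx|reflexivity]. }
    pose proof (Rinv_0_lt_compat _ (Pq p)) as Pi.
    destruct (supnorm a b (Diter a b p f)) as [v| |]; simpl in L |- *.
    - apply Rmult_le_compat_r; lra.
    - destruct (Rle_dec 0 (/ q p)) as [Hd|Hd]; [|lra].
      destruct (Rle_lt_or_eq_dec 0 (/ q p) Hd); [exact I|lra].
    - contradiction. }
  assert (Sa : segment a b a) by (unfold segment; lra).
  pose proof (UB O a Sa) as U0.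
  assert (F0 : 0 <= Cmod (Diter a b 0 f a) / q O)
    by (apply Rmult_le_pos; [apply Cmod_ge_0|apply Rlt_le, Rinv_0_lt_compat, Pq]).
  destruct (levelN a b r f) as [N| |]; simpl in HL, U0, UB |- *; try contradiction.
  split; [exact (Rle_trans _ _ _ F0 U0)|split; [reflexivity|]].
  intros x p Sx. specialize (UB p x Sx).
  unfold taylor_of. rewrite Cmod_mult, Cmod_R, Rabs_pos_eq
    by apply Rlt_le, Rinv_0_lt_compat, INR_fact_lt_0.
  pose proof (INR_fact_lt_0 p) as Pf. pose proof (pow_lt r p Hr) as Pr.
  apply (Rmult_le_compat_r (r ^ p)) in UB; [|lra].
  replace (/ INR (fact p) * Cmod (Diter a b p f x))
    with (Cmod (Diter a b p f x) / q p * r ^ p); [exact UB|].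
  unfold q; field; lra.
Qed.

(** * Estimates *)

Lemma geom_le A r M p : 0 <= A -> 0 <= r -> r <= M -> 0 < M ->
  A * r ^ p * (/ (2 * M)) ^ p <= A * (1 / 2) ^ p.
Proof.
  intros HA Hr HM PM. rewrite Rmult_assoc, <- Rpow_mult_distr.
  apply Rmult_le_compat_l; [exact HA|]. apply pow_incr; split.
  - apply Rmult_le_pos; [exact Hr|apply Rlt_le, Rinv_0_lt_compat; lra].
  - apply Rmult_le_reg_r with (2 * M); [lra|]. field_simplify; lra.
Qed.

(** Cauchy estimate: at [x = 1 / (2 M)] the norm of [U] is at most [2 A] and
    that of [G'] at most [2 B s], so the coefficient of degree [n - 1] of
    [U^n G'] is at most [(2 A)^n (2 B s) (2 M)^(n-1)].  As
    [4 A M |z| <= 1/2], the terms [n >= 1] of the series at [z] are bounded by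
    [(B s / M) (1/2)^n]. *)
Lemma lagrange_l1_le U G A B r s M z :
  0 < A -> 0 <= B -> 0 < r -> 0 < s -> r <= M -> 2 * s <= M -> 8 * A * M * Cmod z <= 1 ->
  (forall p, Cmod (U p) <= A * r ^ p) -> (forall p, Cmod (G p) <= B * s ^ p) ->
  l1_le (fscale z (lagrange U G - fconst (G O))%fps) (2 * (B * s / M)).
Proof.
  intros HA HB Hr Hs HrM HsM Hz HU HG.
  assert (PM : 0 < M) by lra.
  assert (Px : 0 < / (2 * M)) by (apply Rinv_0_lt_compat; lra).
  set (x := / (2 * M)) in *.
  assert (PBM : 0 <= B * s / M).
  { apply Rmult_le_pos; [apply Rmult_le_pos; lra|apply Rlt_le, Rinv_0_lt_compat, PM]. }
  assert (NU : l1_le (fscale x U) (2 * A)).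
  { apply l1_le_geom; intro p. unfold fscale.
    rewrite Cmod_mult, Cmod_pow, Cmod_R, Rabs_pos_eq by lra.
    eapply Rle_trans; [|apply (geom_le A r M p); lra].
    apply Rmult_le_compat_r; [apply pow_le, Rlt_le, Px|apply HU]. }
  assert (NG : l1_le (fscale x (fder G)) (2 * (B * s))).
  { apply l1_le_geom; intro p. unfold fscale, fder.
    rewrite !Cmod_mult, Cmod_pow, !Cmod_R, !Rabs_pos_eq by (apply pos_INR || lra).
    (* The factor [p + 1] of the derivative is absorbed by doubling the ratio [s]. *)
    assert (E : INR (S p) <= 2 ^ p).
    { induction p as [|p IH]; [simpl; lra|]. rewrite S_INR.
      pose proof (pow_R1_Rle 2 p ltac:(lra)). simpl pow. lra. }
    eapply Rle_trans; [|apply (geom_le (B * s) (2 * s) M p); nra].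
    apply Rmult_le_compat_r; [apply pow_le, Rlt_le, Px|].
    apply Rle_trans with (2 ^ p * (B * s ^ S p)).
    - apply Rmult_le_compat; [apply pos_INR|apply Cmod_ge_0|exact E|apply HG].
    - rewrite Rpow_mult_distr. simpl. apply Req_le; ring. }
  apply l1_le_geom; intros [|m]; unfold fscale.
  - replace ((lagrange U G - fconst (G O))%fps O) with (RtoC 0).
    + rewrite Cmult_0_l, Cmod_0. simpl; lra.
    + unfold fsub, fadd, fopp. rewrite lagrange_coef_0. simpl; ring.
  - replace ((lagrange U G - fconst (G O))%fps (S m)) with (lagrange U G (S m))
      by (unfold fsub, fadd, fopp; simpl; ring).
    rewrite Cmod_mult, Cmod_pow.
    pose proof (l1_le_coef _ _ m (l1_le_mul _ _ _ _ (l1_le_pow _ _ (S m) NU) NG)) as E.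
    rewrite <- fscale_pow, <- fscale_mul in E. unfold fscale in E.
    rewrite Cmod_mult, Cmod_pow, Cmod_R, Rabs_pos_eq, <- lagrange_coef_S, Cmod_mult, Cmod_R,
      (Rabs_pos_eq (INR (S m))) in E by (apply pos_INR || lra).
    pose proof (Cmod_ge_0 (lagrange U G (S m))) as PL.
    pose proof (pow_lt x m Px) as Pxm.
    assert (E1 : Cmod (lagrange U G (S m)) * x ^ m <= (2 * A) ^ S m * (2 * (B * s))).
    { refine (Rle_trans _ _ _ _ E). apply Rmult_le_compat_r; [lra|].
      rewrite S_INR. pose proof (pos_INR m). nra. }
    apply (Rmult_le_compat_r ((2 * M) ^ m * Cmod z ^ S m)) in E1.
    2: { apply Rmult_le_pos; apply pow_le; [lra|apply Cmod_ge_0]. }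
    replace (Cmod (lagrange U G (S m)) * x ^ m * ((2 * M) ^ m * Cmod z ^ S m))
      with (Cmod (lagrange U G (S m)) * Cmod z ^ S m * (x * (2 * M)) ^ m) in E1
      by (rewrite Rpow_mult_distr; ring).
    replace (x * (2 * M)) with 1 in E1 by (unfold x; field; lra).
    rewrite pow1, Rmult_1_r in E1. refine (Rle_trans _ _ _ E1 _).
    replace ((2 * A) ^ S m * (2 * (B * s)) * ((2 * M) ^ m * Cmod z ^ S m))
      with (B * s / M * (4 * A * M * Cmod z) ^ S m).
    + apply Rmult_le_compat_l; [exact PBM|]. apply pow_incr.
      pose proof (Cmod_ge_0 z). split; [|lra].
      repeat apply Rmult_le_pos; lra.
    + replace (4 * A * M * Cmod z) with ((2 * A) * (2 * M) * Cmod z) by ring.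
      rewrite !Rpow_mult_distr. simpl. field; lra.
Qed.

(** If [rho] is finite and [q = B / rho], then [2 B s / M <= B / (1 + q)], and
    [B / (1 + q) = rho q / (1 + q) < rho]. *)
Lemma radius_margin (B s : R) (rho : Rbar) : 0 <= B -> 0 < s -> Rbar_lt (Finite 0) rho ->
  0 <= real (Rbar_div (Finite B) rho) /\
  forall M, 2 * ((1 + real (Rbar_div (Finite B) rho)) * s) <= M ->
    Rbar_lt (Finite (2 * (B * s / M))) rho.
Proof.
  intros HB Hs Hrho. destruct rho as [rho| |]; simpl in Hrho |- *.
  - assert (Pq : 0 <= B * / rho)
      by (apply Rmult_le_pos; [exact HB|apply Rlt_le, Rinv_0_lt_compat, Hrho]).
    split; [exact Pq|]. intros M HM.
    assert (PM : 0 < M) by nra.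
    apply Rmult_lt_reg_r with M; [exact PM|].
    replace (2 * (B * s / M) * M) with (2 * (B * s)) by (field; lra).
    apply Rlt_le_trans with (rho * (2 * ((1 + B * / rho) * s))).
    + replace (rho * (2 * ((1 + B * / rho) * s))) with (2 * (B * s) + 2 * (rho * s))
        by (field; lra). nra.
    + apply Rmult_le_compat_l; lra.
  - rewrite Rmult_0_r. split; [lra|]. intros; exact I.
  - contradiction.
Qed.

(** When [A = 0] there is no restriction on [z]; a small positive constant then
    replaces [A] as a bound. *)
Lemma majorant_constant A M (z : C) : 0 <= A -> 0 < M ->
  Rbar_lt (Finite (Cmod z)) (inv_pinfty (8 * A * M)) ->
  exists A', 0 < A' /\ A <= A' /\ 8 * A' * M * Cmod z <= 1.
Proof.
  intros HA HM Hz. pose proof (Cmod_ge_0 z) as Pz. unfold inv_pinfty in Hz.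
  destruct (Req_EM_T (8 * A * M) 0) as [E|N].
  - exists (/ (8 * M * (Cmod z + 1))).
    assert (P : 0 < 8 * M * (Cmod z + 1)) by (apply Rmult_lt_0_compat; lra).
    split; [apply Rinv_0_lt_compat, P|]. split.
    + assert (A = 0) by nra. subst A. apply Rlt_le, Rinv_0_lt_compat, P.
    + apply Rmult_le_reg_r with (Cmod z + 1); [lra|].
      replace (8 * / (8 * M * (Cmod z + 1)) * M * Cmod z * (Cmod z + 1)) with (Cmod z)
        by (field; lra). lra.
  - simpl in Hz. assert (PA : 0 < A) by (destruct HA as [HA|HA]; [exact HA|subst A; lra]).
    exists A. split; [exact PA|]. split; [lra|].
    assert (P : 0 < 8 * A * M) by (apply Rmult_lt_0_compat; lra).
    apply Rle_trans with (8 * A * M * / (8 * A * M)).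
    + apply Rmult_le_compat_l; lra.
    + rewrite Rinv_r; lra.
Qed.

(** * The theorem *)

Theorem mainTheorem5 :
  forall (a b : R), a < b ->
  forall (u g : R -> C) (r s : R), 0 < r -> 0 < s ->
  of_level a b r u -> of_level a b s g ->
  forall c : nat -> C,
  Rbar_lt (Finite 0) (C_radius c) ->
  forall (t : R) (z : C), segment a b t ->
  Rbar_lt (Finite (Cmod z))
    (inv_pinfty (4 * real (levelN a b r u) * T0 a b r s g (C_radius c))) ->
  ex_C_pseries (lagrange_coef a b u g t) z /\
  Rbar_lt (Finite (Cmod (C_PSeries (lagrange_coef a b u g t) z - g t)%C))
    (C_radius c) /\
  ex_C_pseries (lagrange_coef a b u (fun x => phi c g t (g x)) t) z /\
  phi c g t (C_PSeries (lagrange_coef a b u g t) z) =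
  C_PSeries (lagrange_coef a b u (fun x => phi c g t (g x)) t) z.
Proof.
  intros a b Hab u g r s Hr Hs Hu Hg c Hc t z St Hz.
  destruct (of_level_bound a b r u Hab Hr Hu) as [PA [_ BU]].
  destruct (of_level_bound a b s g Hab Hs Hg) as [PB [EB BG]].
  set (A := real (levelN a b r u)) in *. set (B := real (levelN a b s g)) in *.
  destruct (radius_margin B s (C_radius c) PB Hs Hc) as [Pq Margin].
  unfold T0, S0 in Hz. rewrite EB in Hz.
  set (q := real (Rbar_div (Finite B) (C_radius c))) in *.
  set (M := Rmax r (2 * ((1 + q) * s))) in *.
  pose proof (Rmax_l r (2 * ((1 + q) * s))) as M1.
  pose proof (Rmax_r r (2 * ((1 + q) * s))) as M2. fold M in M1, M2.
  specialize (Margin M M2).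
  replace (4 * A * (2 * M)) with (8 * A * M) in Hz by ring.
  destruct (majorant_constant A M z PA ltac:(lra) Hz) as [A' [PA' [HA' Hz']]].
  (* The part of the segment where [phi c g t] can be applied to [g x]. *)
  set (I := fun x => segment a b x /\ Rbar_lt (Finite (Cmod (g x - g t)%C)) (C_radius c)).
  assert (HI : rel_open a b I).
  { intros x [Sx Lx]. split; [exact Sx|].
    destruct (Rbar_lt_between _ _ Lx) as [r' [R1 R2]].
    destruct (proj1 Hg O x Sx) as [l Hl].
    destruct (deriv_continuous a b g x l Hl (r' - Cmod (g x - g t)%C)) as [d [Hd Hdx]]; [lra|].
    exists d; split; [exact Hd|]. intros y Sy By. split; [exact Sy|].
    apply (Rbar_lt_trans _ (Finite r')); [|exact R2]. simpl.
    specialize (Hdx y Sy By).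
    replace (g y - g t)%C with ((g y - g x) + (g x - g t))%C by ring.
    eapply Rle_lt_trans; [apply Cmod_triangle|lra]. }
  assert (It : I t).
  { split; [exact St|]. replace (g t - g t)%C with (RtoC 0) by ring. rewrite Cmod_0; exact Hc. }
  set (U := taylor_of a b u). set (G := taylor_of a b g).
  assert (E0 : forall f x, taylor_of a b f x O = f x)
    by (intros f x; unfold taylor_of; simpl; rewrite Rinv_1; ring).
  assert (HU : taylor a b I U) by (apply taylor_smooth; [exact Hab|exact HI|exact (proj1 Hu)]).
  assert (HG : taylor a b I G) by (apply taylor_smooth; [exact Hab|exact HI|exact (proj1 Hg)]).
  set (H := fun x => fcomp (ps_taylor c (G x O - g t)%C) (G x - fconst (G x O))%fps).
  assert (HH : taylor a b I H).
  { refine (taylor_C_PSeries a b I G c (g t) HG _).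
    intros x [_ Lx]. unfold G; rewrite E0; exact Lx. }
  assert (EH : forall x, I x -> phi c g t (g x) = H x O).
  { intros x Ix. unfold H, fcomp, phi, G. rewrite csum_0, E0. unfold ps_taylor. simpl.
    rewrite Rinv_1. ring. }
  assert (Lg : lagrange_coef a b u g t = lagrange (U t) (G t)).
  { apply functional_extensionality; intro n.
    apply (lagrange_coef_taylor a b I u g U G); try assumption;
      intros; unfold U, G; rewrite E0; reflexivity. }
  assert (Lh : lagrange_coef a b u (fun x => phi c g t (g x)) t = lagrange (U t) (H t)).
  { apply functional_extensionality; intro n.
    apply (lagrange_coef_taylor a b I u _ U H); try assumption.
    intros; unfold U; rewrite E0; reflexivity. }
  set (L := (lagrange (U t) (G t) - fconst (G t O))%fps).
  assert (LL : lagrange (U t) (G t - fconst (G t O))%fps = L).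
  { unfold L, fsub. rewrite lagrange_add.
    replace (- fconst (G t O))%fps with (fconst (- G t O)%C);
      [rewrite lagrange_const; reflexivity|].
    apply functional_extensionality; intros [|n]; unfold fopp; simpl; ring. }
  assert (LH : lagrange (U t) (H t) = fcomp c L).
  { unfold H. unfold G at 1. rewrite E0.
    replace (g t - g t)%C with (RtoC 0) by ring.
    rewrite ps_taylor_0, lagrange_fcomp, LL; [reflexivity|].
    unfold fsub, fadd, fopp; simpl; ring. }
  assert (NL : l1_le (fscale z L) (2 * (B * s / M))).
  { apply (lagrange_l1_le (U t) (G t) A' B r s M z); try assumption; try lra.
    - nra.
    - intro p. eapply Rle_trans; [exact (BU t p St)|].
      apply Rmult_le_compat_r; [apply pow_le; lra|exact HA'].
    - intro p; exact (BG t p St). }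
  destruct (l1_le_tends _ _ NL) as [l [Tl Bl]].
  assert (TG : tends (csum (fscale z (lagrange (U t) (G t)))) (l + g t)%C).
  { apply (tends_ext (fun N => csum (fscale z L) N + g t)%C).
    - intro N. rewrite <- (csum_fscale_fconst z (g t) N), <- csum_plus.
      apply csum_ext; intros k _. unfold fscale, L, fsub, fadd, fopp, G. rewrite E0. ring.
    - apply tends_plus; [exact Tl|apply tends_const]. }
  assert (TH : tends (csum (fscale z (fcomp c L))) (C_PSeries c l)).
  { rewrite fscale_fcomp. apply (tends_csum_fcomp c _ (2 * (B * s / M))); try assumption.
    unfold fscale, L, fsub, fadd, fopp. rewrite lagrange_coef_0. simpl; ring. }
  rewrite Lg, Lh, LH, (C_PSeries_unique _ _ _ TG), (C_PSeries_unique _ _ _ TH).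
  split; [exists (l + g t)%C; apply is_pseries_tends, TG|]. split.
  - replace (l + g t - g t)%C with l by ring.
    apply (Rbar_le_lt_trans _ (Finite (2 * (B * s / M)))); [exact Bl|exact Margin].
  - split; [exists (C_PSeries c l); apply is_pseries_tends, TH|].
    unfold phi. f_equal. ring.
Qed.
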